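(* Let $p$ be a prime and let $(X_n)_{n\ge0}$ be a $\mathbb{Z}_p$-tower of strongly connected digraphs over $X=X_0$ with associated voltage assignment $\alpha:\mathbb{E}(X)\to\mathbb{Z}_p$. Assume that $\mathcal{L}_p(X,\alpha)\ne0$. Then $a(X_n)$ and $b(X_n)$ are uniformly bounded (in $n$). In particular, $\delta(X_n)$ is bounded independently of $n$.
   Context: **Digraphs and towers.** A digraph $X$ consists of finite sets $V(X)$ (vertices) and $\mathbb{E}(X)$ (directed edges) with an incidence map $e\mapsto(o(e),t(e))\in V(X)\times V(X)$. It is strongly connected if for all $(v,v')$ there is a directed path from $v$ to $v'$. A morphism of digraphs is a pair of maps on vertices and edges commuting with incidence. A covering $Y\to X$ is a surjective morphism $f$ which for each $v\in V(Y)$ induces bijections from the incoming (resp. outgoing) edges at $v$ to those at $f(v)$. It is $m$-sheeted if each vertex of $X$ has $m$ preimages, and Galois if it is $m$-sheeted with $|\mathrm{Deck}(Y/X)|=m$ for some $m$, where $\mathrm{Deck}(Y/X)$ (the Galois group) is the group of automorphisms of $Y$ over $X$. A $\mathbb{Z}_p$-tower over $X$ is a sequence of coverings $X=X_0\leftarrow X_1\leftarrow\cdots$ such that each $X_n/X$ is Galois with group isomorphic to $\mathbb{Z}/p^n\mathbb{Z}$; it is a tower of strongly connected digraphs if all $X_n$ are strongly connected. Such a tower comes from a voltage assignment $\alpha:\mathbb{E}(X)\to\mathbb{Z}_p$: $X_n$ is (compatibly with the coverings) the derived digraph with vertices $V(X)\times\mathbb{Z}/p^n\mathbb{Z}$,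 edges $\mathbb{E}(X)\times\mathbb{Z}/p^n\mathbb{Z}$, and $(e,\sigma)$ going from $(o(e),\sigma)$ to $(t(e),\sigma+\alpha(e))$. Fix such an $\alpha$. **$p$-adic Bowen–Franks function.** Let $\mathbb{Z}[T;\mathbb{Z}_p]$ be the ring of finite $\mathbb{Z}$-linear combinations of $T^a$, $a\in\mathbb{Z}_p$. With $V(X)=\{v_1,\dots,v_r\}$, let $A_\alpha$ be the $r\times r$ matrix whose $(i,j)$-entry is $\sum_eT^{\alpha(e)}$, the sum over edges $e$ from $v_j$ to $v_i$, and $\mathcal{L}_p(X,\alpha)=\det(\mathrm{Id}-A_\alpha)\in\mathbb{Z}[T;\mathbb{Z}_p]$. **Defect.** For a digraph $Y$ with vertices $v_1,\dots,v_s$, let $A_Y$ be the matrix whose $(i,j)$-entry is the number of edges from $v_j$ to $v_i$. The zeta function is $Z_Y(u)=\prod_{[C]}(1-u^{|[C]|})^{-1}$, where $[C]$ runs over equivalence classes (under cyclic permutation) of directed cycles (closed directed paths) that are not an $m$-fold multiple of another cycle for any $m\ge2$, and $|[C]|$ is the number of edges; it equals the rational function $\det(\mathrm{Id}-uA_Y)^{-1}$. Put $\mathcal{BF}(Y)=\mathbb{Z}^s/(\mathrm{Id}-A_Y)\mathbb{Z}^s$, $b(Y)=\mathrm{rank}_{\mathbb{Z}}\mathcal{BF}(Y)$, $a(Y)=-\mathrm{ord}_{u=1}Z_Y(u)$, and $\delta(Y)=a(Y)-b(Y)$. *)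

(* Defs.v *)
From HB Require Import structures.
From mathcomp Require Import all_boot all_order all_fingroup all_algebra.
From mathcomp Require Import generic_quotient ring_quotient.
From mathcomp Require Import finmap.
From mathcomp Require Import boolp classical_sets.
From mathcomp Require Import monalg.

Set Implicit Arguments.
Unset Strict Implicit.
Unset Printing Implicit Defensive.

Import GRing.Theory.

Local Open Scope ring_scope.

(* Loops and multiple edges are allowed; [src] and [tgt] are the maps o, t. *)
Record digraph := Digraph {
  vert : finType;
  edge : finType;
  src : edge -> vert;
  tgt : edge -> vert
}.

Definition strongly_connected (X : digraph) : Prop :=
  forall u v : vert X,
    connect [rel a b | [exists e : edge X, (src e == a) && (tgt e == b)]] u v.

Record dimorph (Y X : digraph) := Dimorph {
  mvert : vert Y -> vert X;
  medge : edge Y -> edge X;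
  msrc : forall e, src (medge e) = mvert (src e);
  mtgt : forall e, tgt (medge e) = mvert (tgt e)
}.

Definition dimorph_id (X : digraph) : dimorph X X :=
  @Dimorph X X id id (fun=> erefl) (fun=> erefl).

Definition dimorph_comp (Z Y X : digraph) (g : dimorph Y X)
    (f : dimorph Z Y) : dimorph Z X :=
  @Dimorph Z X (mvert g \o mvert f) (medge g \o medge f)
    (fun e => etrans (msrc g (medge f e)) (congr1 _ (msrc f e)))
    (fun e => etrans (mtgt g (medge f e)) (congr1 _ (mtgt f e))).

Definition isomorphism (Y X : digraph) (f : dimorph Y X) : Prop :=
  bijective (mvert f) /\ bijective (medge f).

Definition bij_between (S T : Type) (A : S -> Prop) (B : T -> Prop)
    (h : S -> T) : Prop :=
  (forall x, A x -> B (h x)) /\ (forall y, B y -> exists! x, A x /\ h x = y).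

Definition covering (Y X : digraph) (f : dimorph Y X) : Prop :=
  [/\ forall x, exists y, mvert f y = x,
      forall e, exists e', medge f e' = e,
      forall v, bij_between (fun e => tgt e = v) (fun e => tgt e = mvert f v)
                  (medge f)
    & forall v, bij_between (fun e => src e = v) (fun e => src e = mvert f v)
                  (medge f)].

Definition sheeted (Y X : digraph) (f : dimorph Y X) (m : nat) : Prop :=
  forall x : vert X, #|[set y | mvert f y == x]| = m.

(* An automorphism of the digraph Y is a pair of permutations of its vertices
   and of its edges. *)
Definition Deck (Y X : digraph) (f : dimorph Y X) :
    {set {perm vert Y} * {perm edge Y}} :=
  [set g : {perm vert Y} * {perm edge Y} |
           [&& [forall e, src (g.2 e) == g.1 (src e)],
               [forall e, tgt (g.2 e) == g.1 (tgt e)],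
               [forall v, mvert f (g.1 v) == mvert f v]
             & [forall e, medge f (g.2 e) == medge f e]]].

Lemma Deck_group_set (Y X : digraph) (f : dimorph Y X) : group_set (Deck f).
Proof.
apply/group_setP; split=> [|g h].
  by rewrite inE; apply/and4P; split; apply/forallP => x; rewrite /= !perm1.
rewrite !inE => /and4P[/forallP g1 /forallP g2 /forallP g3 /forallP g4].
move=> /and4P[/forallP h1 /forallP h2 /forallP h3 /forallP h4].
apply/and4P; split; apply/forallP => x; rewrite /= !permM.
- by rewrite (eqP (h1 _)) (eqP (g1 _)).
- by rewrite (eqP (h2 _)) (eqP (g2 _)).
- by rewrite (eqP (h3 _)).
- by rewrite (eqP (h4 _)).
Qed.

Canonical Deck_group (Y X : digraph) (f : dimorph Y X) :=
  Group (Deck_group_set f).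

Definition galois (Y X : digraph) (f : dimorph Y X) : Prop :=
  covering f /\ exists m : nat, sheeted f m /\ #|Deck f| = m.

(* The additive group Z/mZ, for m > 0. ['Z_m] would be wrong for m = 1, the
   bottom level m = p ^ 0 of a tower. *)
Notation Zmod m := 'I_m.-1.+1.

(* The reduction map Z/mZ -> Z/dZ, for d dividing m. *)
Definition Zred (m d : nat) (x : Zmod m) : Zmod d := inZp x.
Arguments Zred {m} d x.

Lemma Zred_additive (p n : nat) :
  {morph @Zred (p ^ n.+1) (p ^ n) : x y / x - y}.
Proof.
have dv : ((p ^ n).-1.+1 %| (p ^ n.+1).-1.+1)%N.
  case: p => [|p]; last by rewrite !prednK ?expn_gt0 // dvdn_exp2l.
  by case: n => [|n]; rewrite ?expn0 !exp0n ?dvd1n.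
move=> x y; apply: val_inj => /=.
rewrite modn_dvdm // modnDm.
apply/eqP; rewrite eqn_modDl modn_dvdm // -(eqn_modDr y).
rewrite subnK ?(ltnW (ltn_ord y)) //.
by rewrite eq_sym -modnDmr subnK ?modnn ?(eqP dv) // ltnW ?ltn_pmod.
Qed.

Section Padic.

Variable p : nat.

(* Z_p, as the inverse limit of the groups Z/p^nZ; only its additive group
   structure is needed. *)
Record padic := Padic {
  pcomp :> forall n, Zmod (p ^ n);
  _ : `[< forall n, Zred (p ^ n) (pcomp n.+1) = pcomp n >]
}.

HB.instance Definition _ := [isSub for pcomp].
HB.instance Definition _ := gen_eqMixin padic.
HB.instance Definition _ := gen_choiceMixin padic.

Lemma padicP (a : padic) n : Zred (p ^ n) (a n.+1) = a n.
Proof. by case: a => a /= /asboolP. Qed.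

Lemma padic_eq (a b : padic) : (forall n, a n = b n) -> a = b.
Proof. by move=> ab; apply: val_inj; apply: functional_extensionality_dep. Qed.

Fact padic_zero_subproof :
  `[< forall n, Zred (p ^ n) (0 : Zmod (p ^ n.+1)) = 0 >].
Proof. by apply/asboolP => n; apply: val_inj; rewrite /= mod0n. Qed.

Fact padic_sub_subproof (a b : padic) :
  `[< forall n, Zred (p ^ n) (a n.+1 - b n.+1) = a n - b n >].
Proof. by apply/asboolP => n; rewrite Zred_additive !padicP. Qed.

Definition padic_zero : padic := @Padic (fun=> 0) padic_zero_subproof.
Definition padic_sub (a b : padic) : padic :=
  @Padic (fun n => a n - b n) (padic_sub_subproof a b).
Definition padic_opp (a : padic) : padic := padic_sub padic_zero a.
Definition padic_add (a b : padic) : padic := padic_sub a (padic_opp b).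

Lemma padic_oppE a n : padic_opp a n = - a n.
Proof. by rewrite /= sub0r. Qed.

Lemma padic_addE a b n : padic_add a b n = a n + b n.
Proof. by rewrite [LHS]/= sub0r opprK. Qed.

Fact padic_addA : associative padic_add.
Proof. by move=> a b c; apply: padic_eq => n; rewrite !padic_addE addrA. Qed.
Fact padic_addC : commutative padic_add.
Proof. by move=> a b; apply: padic_eq => n; rewrite !padic_addE addrC. Qed.
Fact padic_add0 : left_id padic_zero padic_add.
Proof. by move=> a; apply: padic_eq => n; rewrite padic_addE add0r. Qed.
Fact padic_addN : left_inverse padic_zero padic_opp padic_add.
Proof.
by move=> a; apply: padic_eq => n; rewrite padic_addE padic_oppE addNr.
Qed.

HB.instance Definition _ :=
  GRing.isZmodule.Build padic padic_addA padic_addC padic_add0 padic_addN.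

End Padic.

Fixpoint tower_map (X : nat -> digraph) (f : forall n, dimorph (X n.+1) (X n))
    (n : nat) : dimorph (X n) (X 0) :=
  match n with
  | 0 => dimorph_id (X 0)
  | k.+1 => dimorph_comp (tower_map f k) (f k)
  end.

Definition Zp_tower (p : nat) (X : nat -> digraph)
    (f : forall n, dimorph (X n.+1) (X n)) : Prop :=
  (forall n, covering (f n)) /\
  (forall n, galois (tower_map f n) /\
             Deck (tower_map f n) \isog [set: Zmod (p ^ n)]).

Section Derived.

Variables (p : nat) (X : digraph) (alpha : edge X -> padic p).

Definition derived (n : nat) : digraph :=
  @Digraph (vert X * Zmod (p ^ n))%type (edge X * Zmod (p ^ n))%type
    (fun e => (src e.1, e.2)) (fun e => (tgt e.1, e.2 + alpha e.1 n)).

Definition derived_vred n (v : vert (derived n.+1)) : vert (derived n) :=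
  (v.1, Zred (p ^ n) v.2).
Definition derived_ered n (e : edge (derived n.+1)) : edge (derived n) :=
  (e.1, Zred (p ^ n) e.2).

End Derived.

(* The tower is isomorphic to the tower of derived digraphs of [alpha],
   compatibly with the coverings X_(n+1) -> X_n and with the identification of
   the derived digraph of level 0 with X_0. *)
Definition tower_voltage (p : nat) (X : nat -> digraph)
    (f : forall n, dimorph (X n.+1) (X n)) (alpha : edge (X 0) -> padic p) :
    Prop :=
  exists phi : forall n, dimorph (X n) (derived alpha n),
    [/\ forall n, isomorphism (phi n),
        (forall v, (mvert (phi 0) v).1 = v) /\
        (forall e, (medge (phi 0) e).1 = e),
        forall n v, derived_vred (mvert (phi n.+1) v) =
                    mvert (phi n) (mvert (f n) v)
      & forall n e, derived_ered (medge (phi n.+1) e) =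
                    medge (phi n) (medge (f n) e)].

(* The group ring Z[G] of an additive abelian group G. The library's product
   on [{malg int[K]}] requires a monoid K without nontrivial units, so only
   its additive structure is reused. *)
Definition group_ring (G : zmodType) : Type := {malg int[G]}.
HB.instance Definition _ (G : zmodType) := GRing.Zmodule.on (group_ring G).

Section GroupRing.

Variable G : zmodType.
Implicit Types g : {malg int[G]}.

(* T^a *)
Definition grT (a : G) : group_ring G := << 1 *g a >>.

Definition gr_mul g1 g2 : {malg int[G]} :=
  \sum_(k1 <- msupp g1) \sum_(k2 <- msupp g2)
    << g1@_k1 * g2@_k2 *g (k1 + k2)%R >>.

Local Open Scope fset_scope.

Fact gr_mulw (d1 d2 : {fset G}) g1 g2 :
  msupp g1 `<=` d1 -> msupp g2 `<=` d2 ->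
  gr_mul g1 g2 =
  \sum_(k1 <- d1) \sum_(k2 <- d2) << g1@_k1 * g2@_k2 *g (k1 + k2)%R >>.
Proof.
move=> le_d1 le_d2; rewrite /gr_mul (big_fset_incl _ le_d1) /=.
  apply/eq_bigr=> k1 _; apply/big_fset_incl => // k _ /mcoeff_outdom ->.
  by rewrite mulr0 monalgU0.
move=> k _ /mcoeff_outdom g1k.
by rewrite big1 => // k' _; rewrite g1k mul0r monalgU0.
Qed.

Fact gr_mulC : commutative gr_mul.
Proof.
move=> g1 g2; rewrite /gr_mul exchange_big; apply/eq_bigr => k1 _.
by apply/eq_bigr => k2 _; rewrite mulrC addrC.
Qed.

Fact gr_mul0 g : gr_mul 0 g = 0.
Proof. by rewrite /gr_mul msupp0 big_seq_fset0. Qed.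

Fact gr_mulUg c k g :
  gr_mul << c *g k >> g =
  \sum_(k' <- msupp g) << c * g@_k' *g (k + k')%R >>.
Proof.
rewrite (gr_mulw msuppU_le (fsubset_refl _)) big_seq_fset1.
by apply/eq_bigr => k' _; rewrite mcoeffUU.
Qed.

Fact gr_mulUU c1 c2 k1 k2 :
  gr_mul << c1 *g k1 >> << c2 *g k2 >> = << c1 * c2 *g (k1 + k2)%R >>.
Proof. by rewrite (gr_mulw msuppU_le msuppU_le) !big_seq_fset1 !mcoeffUU. Qed.

Fact gr_mulE g1 g2 :
  gr_mul g1 g2 = \sum_(k1 <- msupp g1) gr_mul << g1@_k1 *g k1 >> g2.
Proof. by apply/eq_bigr=> k _; rewrite gr_mulUg. Qed.

Fact gr_mul1 : left_id (grT 0) gr_mul.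
Proof.
move=> g; rewrite gr_mulUg [RHS]monalgE.
by apply/eq_bigr=> k _; rewrite mul1r add0r.
Qed.

Fact gr_mulDl : left_distributive gr_mul +%R.
Proof.
move=> g1 g2 g; rewrite (gr_mulw (msuppD_le _ _) (fsubset_refl _)).
rewrite (gr_mulw (fsubsetUl _ (msupp g2)) (fsubset_refl (msupp g))).
rewrite (gr_mulw (fsubsetUr (msupp g1) _) (fsubset_refl (msupp g))).
rewrite -big_split /=; apply/eq_bigr=> k1 _.
rewrite -big_split /=; apply/eq_bigr=> k2 _.
by rewrite mcoeffD mulrDl monalgUD.
Qed.

Fact gr_mulA : associative gr_mul.
Proof.
have DS (I : Type) (s : seq I) (F : I -> {malg int[G]}) g :
    gr_mul (\sum_(i <- s) F i) g = \sum_(i <- s) gr_mul (F i) g.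
  exact: (big_morph (gr_mul^~ g) (fun _ _ => gr_mulDl _ _ _) (gr_mul0 g)).
have SD (I : Type) (s : seq I) (F : I -> {malg int[G]}) g :
    gr_mul g (\sum_(i <- s) F i) = \sum_(i <- s) gr_mul g (F i).
  by rewrite gr_mulC DS; apply/eq_bigr => i _; rewrite gr_mulC.
move=> g1 g2 g3; rewrite [g1]monalgE !DS; apply/eq_bigr=> k1 _.
rewrite [g2]monalgE DS !SD DS; apply/eq_bigr=> k2 _.
rewrite gr_mulUU [gr_mul _ g3]gr_mulUg [RHS]gr_mulUg SD; apply/eq_bigr=> k3 _.
by rewrite gr_mulUU mulrA addrA.
Qed.

Fact gr_one_neq0 : grT 0 != 0.
Proof. by rewrite monalgU_eq0. Qed.

HB.instance Definition _ := GRing.Zmodule_isComNzRing.Build (group_ring G)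
  gr_mulA gr_mulC gr_mul1 gr_mulDl gr_one_neq0.

End GroupRing.

(* Vertices are numbered by [enum_val]. *)
Definition voltage_mx (p : nat) (X : digraph) (alpha : edge X -> padic p) :
    'M[group_ring (padic p)]_#|vert X| :=
  \matrix_(i, j)
    \sum_(e : edge X | (src e == enum_val j) && (tgt e == enum_val i))
      grT (alpha e).

Definition padic_bowen_franks (p : nat) (X : digraph)
    (alpha : edge X -> padic p) : group_ring (padic p) :=
  \det (1%:M - voltage_mx alpha).

Section Zeta.

Variable Y : digraph.

(* Closed directed paths, as nonempty cyclically composable sequences of
   edges. *)
Definition dcycle (c : seq (edge Y)) : bool :=
  (0 < size c)%N && path.cycle (fun e e' => tgt e == src e') c.

Definition primitive_dcycle (c : seq (edge Y)) : Prop :=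
  dcycle c /\
  ~ exists m d, (2 <= m)%N /\ dcycle d /\ c = flatten (nseq m d).

(* Equivalence classes, under rotation, of the primitive cycles with k edges. *)
Definition prime_classes (k : nat) : {set {set k.-tuple (edge Y)}} :=
  [set [set d : k.-tuple (edge Y) | [exists i : 'I_k, d == rot_tuple i c]]
     | c : k.-tuple (edge Y) in [pred c | `[< primitive_dcycle (tval c) >]]].

(* The coefficient of u^k in the power series \prod_[C] (1 - u^|[C]|)^-1: each
   factor with |[C]| > k is 1 modulo u^(k+1), and each other one is
   \sum_j u^(|[C]| j), of which only the terms with j <= k matter. *)
Definition zeta_coef (k : nat) : int :=
  (\prod_(l < k.+1) \prod_(C in prime_classes l)
     \sum_(j < k.+1) 'X^(l * j) : {poly int})`_k.

End Zeta.

Definition numer (F : fieldType) (f : {fraction {poly F}}) : {poly F} :=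
  (frac (repr f)).1.
Definition denom (F : fieldType) (f : {fraction {poly F}}) : {poly F} :=
  (frac (repr f)).2.

(* z = f in the field of formal Laurent series, where [z] stands for the power
   series \sum_k z_k u^k. *)
Definition is_expansion (F : fieldType) (f : {fraction {poly F}})
    (z : nat -> F) : Prop :=
  forall k, \sum_(i < k.+1) (denom f)`_i * z (k - i)%N = (numer f)`_k.

(* The order at u = c of a nonzero rational function. *)
Definition ord_at (F : fieldType) (c : F) (f : {fraction {poly F}}) : int :=
  (mup c (numer f))%:Z - (mup c (denom f))%:Z.

(* The rational function whose expansion is the Euler product. There is exactly
   one, namely det(Id - u A_Y)^-1, so the default value 0 is never taken. *)
Definition zeta (Y : digraph) : {fraction {poly rat}} :=
  xget 0 (fun f => is_expansion f (fun k => (zeta_coef Y k)%:~R)).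

(* a(Y) *)
Definition order_invariant (Y : digraph) : int := - ord_at 1 (zeta Y).

Definition adj_mx (Y : digraph) : 'M[int]_#|vert Y| :=
  \matrix_(i, j)
    (#|[set e : edge Y | (src e == enum_val j) && (tgt e == enum_val i)]|)%:Z.

(* The subgroup (Id - A_Y) Z^s of Z^s. *)
Definition BF_relations (Y : digraph) : {pred 'cV[int]_#|vert Y|} :=
  fun v => `[< exists w, v = (1%:M - adj_mx Y) *m w >].
Arguments BF_relations : clear implicits.

Fact BF_relations_zmod_closed (Y : digraph) : zmod_closed (BF_relations Y).
Proof.
split=> [|v w]; first by apply/asboolP; exists 0; rewrite mulmx0.
move=> /asboolP[v' ->] /asboolP[w' ->]; apply/asboolP.
by exists (v' - w'); rewrite mulmxBr.
Qed.

HB.instance Definition _ (Y : digraph) :=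
  GRing.isZmodClosed.Build _ (BF_relations Y) (BF_relations_zmod_closed Y).

Definition bowen_franks_group (Y : digraph) : zmodType :=
  Quotient.quot (BF_relations Y : zmodClosed _).

Definition Z_independent (M : zmodType) (n : nat) (x : 'I_n -> M) : Prop :=
  forall c : 'I_n -> int, \sum_i x i *~ c i = 0 -> forall i, c i = 0.

(* The rank of an abelian group: the maximal number of Z-linearly independent
   elements. It exists for a finitely generated group, the only case used. *)
Definition Z_rank (M : zmodType) : nat :=
  xget 0%N (fun n => (exists x : 'I_n -> M, Z_independent x) /\
    (forall m (x : 'I_m -> M), Z_independent x -> (m <= n)%N)).

(* b(Y) *)
Definition rank_invariant (Y : digraph) : nat := Z_rank (bowen_franks_group Y).

(* delta(Y) *)
Definition defect (Y : digraph) : int :=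
  order_invariant Y - (rank_invariant Y)%:Z.

(* Main.v *)
(* Write [D_Y(u) = det(1 - u A_Y)]. Both [D_Y] and the inverse of the Euler
   product of [Y] have constant term 1 and logarithmic derivative
   [- sum_i tr(A_Y^(i+1)) u^i]: the former by Jacobi's formula, the latter
   because a closed walk of length [k] is uniquely a power of a primitive one,
   whose rotation class has [l] elements for some [l] dividing [k]. Hence
   [a(Y)] is the multiplicity of [1] as a root of [D_Y], and it bounds [b(Y)],
   which is the dimension of the kernel of [1 - A_Y].

   Counting closed walks of the derived digraph with the characters of
   [Z/p^nZ] gives [D_{X_n} = prod_chi det(1 - u chi(A_alpha))]; each factor
   has degree at most [r = #|V(X)|], and does not vanish at [u = 1] unless
   [chi(L_p) = 0]. Let [n0] be such that the exponents of [L_p] are distinct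
   modulo [p^n0], and let [chi] be of order [p^(m+1)] with [m >= n0]. If
   [chi(L_p) = 0], then the cyclotomic polynomial of index [p^(m+1)] divides
   the reduction of [L_p] modulo [T^(p^(m+1)) - 1], whose coefficients are
   thus constant on the classes modulo [p^m]; this is absurd, as each class
   has [p] elements and contains at most one exponent. So at most [p^n0]
   characters contribute, and [a(X_n) <= p^n0 r]. *)
From HB Require Import structures.
Require Import Defs.
From mathcomp Require Import all_boot all_order all_fingroup all_algebra.
From mathcomp Require Import all_field.
From mathcomp Require Import generic_quotient finmap boolp.
From mathcomp Require Import classical_sets monalg.

Set Implicit Arguments.
Unset Strict Implicit.
Unset Printing Implicit Defensive.

Import Order.TTheory GRing.Theory Num.Theory.

Local Open Scope ring_scope.

(** * Logarithmic derivatives of polynomials *)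

Section TruncatedEquality.

Variable R : comNzRingType.
Implicit Types p q r : {poly R}.

Definition eqX n p q := forall i, (i < n)%N -> p`_i = q`_i.

Lemma eqX_sym n p q : eqX n p q -> eqX n q p.
Proof. by move=> pq i /pq. Qed.

Lemma eqX_trans n q p r : eqX n p q -> eqX n q r -> eqX n p r.
Proof. by move=> pq qr i ni; rewrite pq ?qr. Qed.

Lemma eqX_leq m n p q : (m <= n)%N -> eqX n p q -> eqX m p q.
Proof. by move=> mn pq i im; apply: pq; apply: leq_trans mn. Qed.

Lemma eqXD n p p' q q' : eqX n p p' -> eqX n q q' -> eqX n (p + q) (p' + q').
Proof. by move=> pp qq i ni; rewrite !coefD pp ?qq. Qed.

Lemma eqXM n p p' q q' : eqX n p p' -> eqX n q q' -> eqX n (p * q) (p' * q').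
Proof.
move=> pp qq i ni; rewrite !coefM; apply: eq_bigr => j _.
rewrite pp ?qq //; first exact: leq_ltn_trans (leq_subr _ _) ni.
exact: leq_ltn_trans (leq_ord _) ni.
Qed.

Lemma eqXMl n p q q' : eqX n q q' -> eqX n (p * q) (p * q').
Proof. by apply: eqXM. Qed.

Lemma eqX_prod n (I : Type) (s : seq I) (P : pred I) (F G : I -> {poly R}) :
  (forall i, P i -> eqX n (F i) (G i)) ->
  eqX n (\prod_(i <- s | P i) F i) (\prod_(i <- s | P i) G i).
Proof.
move=> FG; elim/big_rec2: _ => // i p q Pi pq; apply: eqXM => //.
exact: FG.
Qed.

(* [- sum_(i < n) t_i X^i] is the logarithmic derivative of [q] modulo [X^n];
   when [q = prod_j (1 - a_j X)], [t_i] is the power sum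
   [sum_j a_j ^ (i + 1)]. *)
Definition logder n (t : nat -> R) q := eqX n q^`() (- \poly_(i < n) t i * q).

Lemma eq_logder n t s q : logder n t q ->
  (forall i, (i < n)%N -> t i = s i) -> logder n s q.
Proof.
move=> tq ts; move: tq; rewrite /logder.
rewrite (_ : \poly_(i < n) t i = \poly_(i < n) s i) //.
by apply/polyP => i; rewrite !coef_poly; case: ifP => // /ts.
Qed.

Lemma logder1 n : logder n (fun=> 0) 1.
Proof.
move=> i ni; rewrite (_ : 1 = 1%:P) // derivC coef0 mulr1 coefN.
by rewrite coef_poly ni oppr0.
Qed.

Lemma logderM n t s p q : logder n t p -> logder n s q ->
  logder n (fun i => t i + s i) (p * q).
Proof.
move=> tp sq; rewrite /logder derivM.
have -> : \poly_(i < n) (t i + s i) = \poly_(i < n) t i + \poly_(i < n) s i.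
  by apply/polyP => i; rewrite coefD !coef_poly; case: ifP; rewrite ?addr0.
rewrite opprD mulrDl mulrA (mulrCA _ p).
apply: eqXD; last exact: eqXMl.
by apply: eqXM.
Qed.

Lemma logder_prod n (I : Type) (r : seq I) (t : I -> nat -> R)
    (F : I -> {poly R}) :
  (forall i, logder n (t i) (F i)) ->
  logder n (fun k => \sum_(i <- r) t i k) (\prod_(i <- r) F i).
Proof.
move=> tF; elim: r => [|i r IHr].
  by rewrite big_nil; apply (eq_logder (@logder1 n)) => k _; rewrite big_nil.
rewrite big_cons; apply (eq_logder (logderM (tF i) IHr)) => k _.
by rewrite big_cons.
Qed.

Lemma logder_exp n t q m : logder n t q ->
  logder n (fun i => t i *+ m) (q ^+ m).
Proof.
move=> tq; elim: m => [|m IHm].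
  by apply (eq_logder (@logder1 n)) => i _; rewrite mulr0n.
rewrite exprS; apply (eq_logder (logderM tq IHm)) => i _.
by rewrite mulrS.
Qed.

(** Expand [- l X^(l-1) / (1 - X^l)] as a geometric series. *)
Lemma logder_1subXn n l : (0 < l)%N ->
  logder n (fun i => if (l %| i.+1)%N then l%:R else 0) (1 - 'X^l).
Proof.
move=> l0 i ni; rewrite derivB derivXn (_ : 1 = 1%:P) // derivC.
rewrite sub0r mulrBr mulr1 mulNr opprK coefN coefD coefMn coefXn coefN.
rewrite coefMXn !coef_poly ni.
(* Below degree [l] only [i = l - 1] contributes; from [l] on, the terms of degrees [i] and [i - l]
   cancel. *)
case: (ltnP i l) => [il|li].
  rewrite addr0; congr (- _); case: (eqVneq i l.-1) => [->|ne].
    by rewrite prednK ?dvdnn.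
  case: ifP => [/dvdn_leq -/(_ isT) li|]; last by rewrite mul0rn.
  case/eqP: ne; apply/eqP.
  by rewrite -eqSS prednK // eqn_leq il li.
rewrite (leq_ltn_trans (leq_subr _ _) ni) -subSn // dvdn_subl // ?leqW //.
rewrite addNr; case: eqP => [il|]; last by rewrite mul0rn oppr0.
by move: li; rewrite il leqNgt prednK ?leqnn.
Qed.

End TruncatedEquality.

(** The coefficient of [X^k] in the defining equation expresses [k.+1] times the next coefficient
    through earlier ones, and [k.+1] is invertible in characteristic 0. *)
Lemma logder_uniq (F : numFieldType) n t (p q : {poly F}) :
  p`_0 = q`_0 -> logder n t p -> logder n t q -> eqX n.+1 p q.
Proof.
move=> pq0 tp tq; elim/ltn_ind => -[//|k] IH; rewrite ltnS => kn.
have := tp k kn; have := tq k kn; rewrite !coef_deriv !mulNr !coefN !coefM.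
set S := \sum_(i < _) _; set S' := \sum_(i < _) _ => qS pS.
have SS : S = S'.
  apply: eq_bigr => i _; rewrite IH ?ltnS ?leq_subr //.
  exact: leq_trans (leq_subr _ _) (ltnW kn).
move: pS; rewrite -SS -qS => /eqP.
rewrite -[_ *+ k.+1]mulr_natr -[X in _ == X]mulr_natr => /eqP/mulIf; apply.
by rewrite pnatr_eq0.
Qed.

(** * Jacobi's formula and the polynomial [det(1 - X A)] *)

Section Determinant.

Variable R : comNzRingType.

Lemma deriv_prodr (I : finType) (F : I -> {poly R}) :
  (\prod_i F i)^`() = \sum_i (F i)^`() * \prod_(j | j != i) F j.
Proof.
have H (r : seq I) : uniq r -> (\prod_(i <- r) F i)^`() =
    \sum_(i <- r) (F i)^`() * \prod_(j <- r | j != i) F j.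
  elim: r => [_|i r IHr /= /andP[ir ur]].
    by rewrite !big_nil (_ : 1 = 1%:P) // derivC.
  rewrite !big_cons eqxx /= derivM IHr //; congr (_ * _ + _).
    rewrite [LHS]big_seq [RHS]big_seq_cond; apply: eq_bigl => j.
    by case: (boolP (j \in r)) => //= jr; rewrite (memPn ir).
  rewrite mulr_sumr big_seq [RHS]big_seq; apply: eq_bigr => j jr.
  by rewrite big_cons eq_sym (memPn ir) // mulrCA.
by rewrite H ?index_enum_uniq.
Qed.

(** Jacobi's formula: the [i]-th diagonal entry gathers the Leibniz terms in which the factor from
    row [i] is differentiated. *)
Lemma deriv_det n (M : 'M[{poly R}]_n) :
  (\det M)^`() = \tr (map_mx (fun p => p^`()) M *m \adj M).
Proof.
rewrite /determinant linear_sum /mxtrace.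
have E i : (map_mx (fun p => p^`()) M *m \adj M) i i = \sum_(s : 'S_n)
    (-1) ^+ s * ((M i (s i))^`() * \prod_(k | k != i) M k (s k)).
  rewrite mxE (partition_big (fun s : 'S_n => s i) predT) //=.
  apply: eq_bigr => j _; rewrite !mxE expand_cofactor mulr_sumr.
  apply: eq_bigr => s /eqP <-; rewrite mulrCA; congr (_ * (_ * _)).
  by apply: eq_bigl => k; rewrite eq_sym.
rewrite (eq_bigr _ (fun i _ => E i)) exchange_big /=.
apply: eq_bigr => s _; rewrite derivM deriv_prodr mulr_sumr.
by case: (odd_perm s); rewrite ?expr0 ?expr1 ?derivN (_ : 1 = 1%:P) // derivC;
  rewrite ?oppr0 mul0r add0r.
Qed.

Definition zeta_denom n (A : 'M[R]_n) : {poly R} :=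
  \det (1%:M - 'X *: map_mx polyC A).

Lemma zeta_denom_coef0 n (A : 'M[R]_n) : (zeta_denom A)`_0 = 1.
Proof.
rewrite -horner_coef0 /zeta_denom -horner_evalE -det_map_mx.
rewrite (_ : map_mx _ _ = 1%:M) ?det1 //; apply/matrixP => i j.
rewrite !mxE /= /horner_eval hornerD hornerN hornerM hornerX mul0r subr0.
by rewrite hornerMn hornerC.
Qed.

(** By Jacobi's formula the derivative is [- \tr (B *m \adj M)], and modulo [X^N] the adjugate is
    the determinant times a truncated Neumann series. *)
Lemma logder_zeta_denom N n (A : 'M[R]_n) :
  logder N (fun i => \tr (A ^+ i.+1)) (zeta_denom A).
Proof.
set M : 'M_n := 1%:M - 'X *: map_mx polyC A.
set B : 'M[{poly R}]_n := map_mx polyC A.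
(* The inverse of [M] modulo [X^N], standing in for the power series [M^-1]. *)
pose S : 'M[{poly R}]_n := \sum_(i < N) 'X^i *: B ^+ i.
have MS : M *m S = 1%:M - 'X^N *: B ^+ N.
  rewrite /S; elim: (N) => [|k IHk].
    by rewrite big_ord0 mulmx0 expr0 scale1r expr0 subrr.
  rewrite big_ord_recr /= mulmxDr IHk mulmxBl mul1mx -scalemxAl -scalemxAr.
  by rewrite scalerA -exprS mulmxE -exprS addrA subrK.
have dM : map_mx (fun p => p^`()) M = - B.
  apply/matrixP => i j; rewrite !mxE derivB derivM derivX mul1r derivC mulr0.
  by rewrite addr0 -polyC_natr derivC sub0r.
have adjE : \adj M = zeta_denom A *: S + 'X^N *: (\adj M *m B ^+ N).
  have := congr1 (mulmx (\adj M)) MS.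
  rewrite mulmxA mul_adj_mx mulmxBr mulmx1 mul_scalar_mx -scalemxAr => ->.
  by rewrite subrK.
have trS : \tr (B *m S) = \poly_(i < N) \tr (A ^+ i.+1).
  rewrite /S mulmx_sumr raddf_sum poly_def; apply: eq_bigr => i _.
  rewrite -scalemxAr /= mxtraceZ mulmxE -exprS -rmorphXn /= trace_map_mx.
  by rewrite -mul_polyC mulrC.
move=> i iN; rewrite {1}/zeta_denom deriv_det -/M dM mulNmx raddfN mulNr !coefN.
congr (- _); rewrite adjE mulmxDr raddfD /= coefD -!scalemxAr !mxtraceZ.
by rewrite trS ['X^N * _]mulrC coefMXn iN addr0 mulrC.
Qed.

End Determinant.

(** * Closed walks and primitive cycles *)

Section Repetitions.

Variable T : eqType.
Implicit Types (s d : seq T) (e : rel T).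

Definition pow_seq m d := flatten (nseq m d).

Lemma size_pow_seq m d : size (pow_seq m d) = (m * size d)%N.
Proof. by rewrite size_flatten /shape map_nseq sumn_nseq mulnC. Qed.

Lemma repeat_cat m n d : pow_seq (m + n) d = pow_seq m d ++ pow_seq n d.
Proof. by rewrite /pow_seq nseqD flatten_cat. Qed.

Lemma pow_seqM m n d : pow_seq m (pow_seq n d) = pow_seq (m * n) d.
Proof. by elim: m => // m IHm; rewrite mulSn repeat_cat -IHm. Qed.

Lemma take_pow_seq m d : take (size d) (pow_seq m.+1 d) = d.
Proof. by rewrite take_size_cat. Qed.

Lemma rot_pow_seq m d : rot (size d) (pow_seq m d) = pow_seq m d.
Proof.
case: m => // m; rewrite [X in rot _ X]/pow_seq /= rot_size_cat.
by rewrite -/(pow_seq _ _) -addn1 repeat_cat /= [pow_seq 1 d]cats0.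
Qed.

(** Invariance under rotation by [l] forces the second block of length [l] to repeat the first, and
    the tail inherits the invariance. *)
Lemma rot_fixed_pow_seq l m s : (0 < l)%N -> size s = (m * l)%N ->
  rot l s = s -> s = pow_seq m (take l s).
Proof.
move=> l0; elim: m s => [|m IHm] s; first by move/size0nil.
rewrite mulSn => ss rs; have ls : (l <= size s)%N by rewrite ss leq_addr.
rewrite -{1}(cat_take_drop l s); congr (_ ++ _).
have sd : size (drop l s) = (m * l)%N by rewrite size_drop ss addKn.
case: m => [|m] in IHm ss sd *; first exact/size0nil.
have E : take l s ++ drop l s = drop l s ++ take l s.
  by rewrite cat_take_drop -[LHS]rs.
have td : take l (drop l s) = take l s.
  have := congr1 (take l) E.
  rewrite take_size_cat ?size_take_min ?(minn_idPl _) //.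
  by rewrite takel_cat // sd mulSn leq_addr.
rewrite -td; apply: IHm => //.
have lt : size (take l s) = l by rewrite size_take_min (minn_idPl _).
have dE : drop l s = take l s ++ drop l (drop l s).
  by rewrite -[in RHS]td cat_take_drop.
rewrite /rot td; move: dE E; set a := take l s; set t := drop l s => dE.
by rewrite {2}dE -catA => /eqP; rewrite eqseq_cat // eqxx /= => /eqP.
Qed.

(** The junction between two copies of [d] is the closing step of the cycle [d]. *)
Lemma cycle_pow_seq e m d : path.cycle e (pow_seq m.+1 d) = path.cycle e d.
Proof.
case: d => [|x p].
  by rewrite /pow_seq (_ : flatten _ = [::]) //; elim: m.+1.
have pathE k : path e x (rcons (p ++ pow_seq k (x :: p)) x)
    = path e x (rcons p x).
  elim: k => [|k IHk]; first by rewrite cats0.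
  rewrite [pow_seq _ _]/= -/(pow_seq k (x :: p)) -cat_rcons rcons_cat cat_path.
  by rewrite last_rcons IHk andbb.
exact: pathE m.
Qed.

End Repetitions.

(** * Periods under rotation, primitive walks and their classes *)

Section Period.

Variables (E : finType) (n : nat).
Implicit Types c : n.-tuple E.

Definition rot1_tuple c : n.-tuple E := rot_tuple 1 c.

Lemma rot1_tuple_inj : injective rot1_tuple.
Proof. by move=> c d /(congr1 val) /= /rot_inj /val_inj. Qed.

Lemma iter_rot1 k c : (k <= n)%N -> val (iter k rot1_tuple c) = rot k c.
Proof.
elim: k => [|k IHk] kn; first by rewrite rot0.
by rewrite iterS rotS ?size_tuple // -IHk ?(ltnW kn).
Qed.

Definition period c := fingraph.order rot1_tuple c.

Lemma period_gt0 c : (0 < period c)%N.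
Proof. exact: fingraph.order_gt0. Qed.

Lemma period_dvd k c : (k <= n)%N -> (rot k c == c) = (period c %| k)%N.
Proof.
move=> kn; rewrite -iter_rot1 // val_eqE.
have itm m : iter (m * period c) rot1_tuple c = c.
  elim: m => // m IHm; rewrite mulSn iterD IHm.
  exact: (fingraph.iter_order rot1_tuple_inj).
rewrite {1}(divn_eq k (period c)) addnC iterD itm eq_sym.
by rewrite -(findex_eq0 rot1_tuple) findex_iter // ltn_pmod ?period_gt0.
Qed.


End Period.

Section PrimeClasses.

Variable Y : digraph.
Let E := edge Y.

Definition closed_walks n : {set n.-tuple E} := [set c | dcycle (tval c)].

Definition primitive_walks n : {set n.-tuple E} :=
  [set c | `[< primitive_dcycle (tval c) >]].

Lemma dcycle_pow_seq m (d : seq E) :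
  (0 < m)%N -> dcycle (pow_seq m d) = dcycle d.
Proof.
case: m => // m _; rewrite /dcycle cycle_pow_seq size_pow_seq.
by rewrite muln_gt0.
Qed.

Lemma period_dvd_size n (c : n.-tuple E) : (period c %| n)%N.
Proof. by rewrite -period_dvd // -{1}(size_tuple c) rot_size. Qed.

Lemma pow_seq_period n m (c : n.-tuple E) : n = (m * period c)%N ->
  tval c = pow_seq m (take (period c) c).
Proof.
move=> nE; case: (posnP n) => [n0|n0].
  have/eqP := n0; rewrite {1}nE muln_eq0 (gtn_eqF (period_gt0 c)) orbF.
  by move/eqP->; apply: size0nil; rewrite size_tuple.
apply: rot_fixed_pow_seq; rewrite ?period_gt0 ?size_tuple //.
by apply/eqP; rewrite period_dvd // dvdn_leq ?period_dvd_size.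
Qed.

(** Rotation by [l] fixes [c], so the period divides [l]; a proper divisor would make [d] itself a
    proper power of a closed walk. *)
Lemma period_primitive l m n (d : l.-tuple E) (c : n.-tuple E) :
  (0 < m)%N -> n = (m * l)%N -> primitive_dcycle d ->
  tval c = pow_seq m d -> period c = l.
Proof.
move=> m0 nE [cd pd] cE; have l0 : (0 < l)%N.
  by move: cd => /andP[]; rewrite size_tuple.
have /dvdnP[k lE] : (period c %| l)%N.
  rewrite -period_dvd; last by rewrite nE leq_pmull.
  by rewrite cE -{1}(size_tuple d) rot_pow_seq.
have k0 : (0 < k)%N by case: k lE l0 => // ->.
case: (ltnP 1 k) => [k1|]; last first.
  move=> k1; have kE : k = 1%N by apply/eqP; rewrite eqn_leq k1.
  by rewrite lE kE mul1n.
have ca : tval c = pow_seq (m * k) (take (period c) c).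
  by apply: pow_seq_period; rewrite -mulnA -lE.
case: pd; exists k, (take (period c) c); split=> //; split.
  rewrite -(@dcycle_pow_seq (m * k)) ?muln_gt0 ?m0 // -ca cE.
  by rewrite dcycle_pow_seq.
have tE : take l (pow_seq m d) = d.
  by have := take_pow_seq m.-1 d; rewrite size_tuple prednK.
move: ca; set a := take _ _ => ca; rewrite -tE -cE ca -pow_seqM.
have lEa : l = size (pow_seq k a); last first.
  by rewrite -(prednK m0) lEa take_pow_seq.
rewrite size_pow_seq {1}lE /a size_take_min (minn_idPl _) // size_tuple.
by rewrite dvdn_leq ?period_dvd_size // nE muln_gt0 m0 l0.
Qed.

(** If the first period were a proper power of some [e], rotation by [size e] would already fix [c],
    against minimality of the period. *)
Lemma primitive_take_period n (c : n.-tuple E) :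
  dcycle c -> primitive_dcycle (take (period c) c).
Proof.
move=> cc; have n0 : (0 < n)%N by move: cc => /andP[]; rewrite size_tuple.
have /dvdnP[m nE] := period_dvd_size c.
have m0 : (0 < m)%N by case: m nE n0 => // ->.
have cE := pow_seq_period nE.
have st : size (take (period c) c) = period c.
  rewrite size_take_min size_tuple (minn_idPl _) //.
  by rewrite dvdn_leq ?period_dvd_size.
split; first by rewrite -(dcycle_pow_seq _ m0) -cE.
move=> [k [e [k1 [ce eE]]]]; have /andP[se0 _] := ce.
have {}cE : tval c = pow_seq (m * k) e by rewrite cE eE -pow_seqM.
have le : (size e < period c)%N.
  by rewrite -st eE size_pow_seq -[ltnLHS]mul1n ltn_mul2r se0.
suff /(dvdn_leq se0) : (period c %| size e)%N by rewrite leqNgt le.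
rewrite -period_dvd; first by rewrite {1}cE rot_pow_seq -cE.
by rewrite (leq_trans (ltnW le)) // dvdn_leq ?period_dvd_size.
Qed.

Lemma primitive_walksE l (c : l.-tuple E) :
  (c \in primitive_walks l) = dcycle c && (period c == l).
Proof.
rewrite inE; apply/asboolP/andP => [pc|[cc /eqP cl]].
  split; first by case: pc.
  apply/eqP/(@period_primitive l 1 l c) => //; first by rewrite mul1n.
  by rewrite /pow_seq /= cats0.
have := primitive_take_period cc; rewrite cl.
by rewrite take_oversize ?size_tuple.
Qed.

(** Taking [m]-th powers is a bijection, with inverse the restriction to the first [l] edges. *)
Lemma card_closed_walks_period n m l : n = (m * l)%N -> (0 < m)%N ->
  #|[set c in closed_walks n | period c == l]| = #|primitive_walks l|.
Proof.
move=> nE m0.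
have hP (d : l.-tuple E) : size (pow_seq m d) == n.
  by rewrite size_pow_seq size_tuple nE.
pose h d : n.-tuple E := Tuple (hP d).
rewrite -(card_imset (mem (primitive_walks l)) (f := h)); last first.
  move=> c d /(congr1 val)/= cd; apply: val_inj => /=.
  rewrite -(take_pow_seq m.-1 c) -(take_pow_seq m.-1 d) prednK // cd.
  by rewrite !size_tuple.
apply: eq_card => c; rewrite !inE; apply/andP/imsetP => [[cc /eqP lE]|[d]].
  have tP : size (take l c) == l.
    rewrite size_take_min size_tuple nE.
    by apply/eqP/minn_idPl; rewrite leq_pmull.
  exists (Tuple tP).
    by rewrite inE /=; apply/asboolP; rewrite -lE; apply: primitive_take_period.
  by apply: val_inj; rewrite /= -lE; apply: pow_seq_period; rewrite lE.
rewrite inE => /asboolP pd ->; split.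
  by rewrite /= dcycle_pow_seq //; case: pd.
by apply/eqP; apply: period_primitive nE pd _.
Qed.

Lemma card_prime_classes0 : #|prime_classes Y 0| = 0%N.
Proof.
apply: eq_card0 => C; apply/imsetP => -[c].
move=> pc; have /asboolP[/andP[s0 _] _] : `[< primitive_dcycle c >] by [].
by rewrite size_tuple in s0.
Qed.

(** The prime classes are the rotation orbits of primitive walks, and such an orbit has as many
    elements as the period, which is [l]. *)
Lemma card_primitive_walks l :
  #|primitive_walks l| = (l * #|prime_classes Y l|)%N.
Proof.
case: (posnP l) => [->|l0].
  rewrite mul0n; apply: eq_card0 => c; rewrite inE.
  by apply/asboolP => -[/andP[s0 _]]; rewrite size_tuple in s0.
have per (c : l.-tuple E) : c \in primitive_walks l -> period c = l.
  by rewrite primitive_walksE => /andP[_ /eqP].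
pose orb (c : l.-tuple E) := [set d | fconnect (@rot1_tuple E l) c d].
have orbE c : c \in primitive_walks l ->
    [set d : l.-tuple E | [exists i : 'I_l, d == rot_tuple i c]] = orb c.
  move=> pc; apply/setP => d; rewrite !inE; apply/existsP/idP => [[i /eqP ->]|].
    suff -> : rot_tuple i c = iter i (@rot1_tuple E l) c.
      exact: fconnect_iter.
    by apply: val_inj; rewrite iter_rot1 // ltnW.
  move=> cd; have lt := findex_max cd; rewrite -/(period c) per // in lt.
  exists (Ordinal lt); rewrite -{1}(iter_findex cd); apply/eqP/val_inj.
  by rewrite iter_rot1 // ltnW.
have -> : prime_classes Y l = orb @: primitive_walks l.
  rewrite /prime_classes; apply/setP => C.
  apply/imsetP/imsetP => -[c pc ->]; exists c.
  - by rewrite inE.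
  - by apply: orbE; rewrite inE.
  - by move: pc; rewrite inE.
  - by rewrite orbE.
rewrite -sum1_card (partition_big_imset orb) /= -sum1_card big_distrr /=.
rewrite muln1; apply: eq_bigr => C /imsetP[c pc ->].
rewrite sum1_card; apply: etrans (per c pc); rewrite /period /fingraph.order.
apply: eq_card => d; rewrite [LHS]unfold_in /=.
have sym := fconnect_sym (@rot1_tuple_inj E l).
apply/andP/idP => [[_ /eqP dc]|cd].
  have : d \in orb d by rewrite inE connect0.
  by rewrite dc inE.
split; last first.
  by apply/eqP/setP => x; rewrite !inE; apply: same_connect; rewrite // sym.
rewrite -(iter_findex cd); have lt := findex_max cd.
rewrite -/(period c) per // in lt; move: pc; rewrite !primitive_walksE.
rewrite iter_findex // /dcycle !size_tuple => /andP[/andP[-> cc] /eqP cl].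
apply/andP; split; last first.
  apply/eqP/(etrans _ cl)/eq_card => x.
  by apply: same_connect; rewrite // sym.
by rewrite -(iter_findex cd) iter_rot1 ?rot_cycle // ltnW.
Qed.

End PrimeClasses.

(** * Walks and traces *)

Section WalkSums.

Variables (R : comNzRingType) (X : digraph) (w : edge X -> R).

Fixpoint walk_sum k (u v : vert X) : R :=
  if k is k'.+1 then \sum_(e | src e == u) w e * walk_sum k' (tgt e) v
  else (u == v)%:R.

Definition weight_mx : 'M[R]_#|vert X| :=
  \matrix_(i, j)
    \sum_(e | (src e == enum_val j) && (tgt e == enum_val i)) w e.

Lemma weight_mxX k i j :
  (weight_mx ^+ k) i j = walk_sum k (enum_val j) (enum_val i).
Proof.
elim: k j => [|k IHk] j.
  by rewrite expr0 mxE /= (inj_eq enum_val_inj) eq_sym.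
(* Columns index sources, so the first edge of the walk is the rightmost factor. *)
rewrite exprSr mxE /= (partition_big (fun e => enum_rank (tgt e)) predT) //=.
apply: eq_bigr => l _; rewrite IHk mxE mulr_sumr.
have tE (e : edge X) : (enum_rank (tgt e) == l) = (tgt e == enum_val l).
  by rewrite -(inj_eq enum_val_inj) enum_rankK.
apply: eq_big => [e|e /andP[_ /eqP ->]]; first by rewrite tE.
by rewrite mulrC.
Qed.

Lemma mxtrace_weight_mxX k : \tr (weight_mx ^+ k) = \sum_v walk_sum k v v.
Proof.
rewrite /mxtrace (reindex _ (onW_bij _ (@enum_val_bij (vert X)))) /=.
by apply: eq_bigr => i _; rewrite weight_mxX.
Qed.

End WalkSums.

Section ClosedWalks.

Variable Y : digraph.

Fixpoint is_walk (u : vert Y) (c : seq (edge Y)) (v : vert Y) : bool :=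
  if c is e :: c' then (src e == u) && is_walk (tgt e) c' v else u == v.

Lemma card_walks (R : comNzRingType) k u v :
  #|[set t : k.-tuple (edge Y) | is_walk u t v]|%:R
  = walk_sum (fun=> 1 : R) k u v.
Proof.
elim: k u => [|k IHk] u.
  rewrite /= cardsE; case: eqP => [uv|ne].
    rewrite (@eq_card _ _ predT) ?card_tuple // => t.
    by rewrite [LHS]unfold_in (tuple0 t) /= uv eqxx.
  by rewrite eq_card0 // => t; rewrite [LHS]unfold_in (tuple0 t) /=; apply/eqP.
rewrite -sum1_card /=; under eq_bigl => t do rewrite inE.
pose h (p : edge Y * k.-tuple (edge Y)) : k.+1.-tuple (edge Y) :=
  [tuple of p.1 :: p.2].
rewrite (reindex h) /=; last first.
  exists (fun t => (thead t, [tuple of behead t])) => [[e t] _|t _].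
    by congr pair; apply: val_inj.
  by rewrite /h /= -tuple_eta.
rewrite -(pair_big_dep (fun e => src e == u)
  (fun e t => is_walk (tgt e) (tval t) v) (fun _ _ => 1%N)) /=.
rewrite natr_sum; apply: eq_bigr => e _.
rewrite mul1r -IHk sum1_card; congr _%:R; apply: eq_card => t.
by rewrite inE.
Qed.

(** Only the source of the first edge can contribute; the sum over [v] is what turns a count of
    cycles into a trace. *)
Lemma dcycle_is_walk (c : seq (edge Y)) : (0 < size c)%N ->
  dcycle c = (\sum_v is_walk v c v)%N :> nat.
Proof.
case: c => // e c _; rewrite (bigD1 (src e)) //= eqxx big1 => [|v]; last first.
  by rewrite eq_sym => /negbTE->.
rewrite addn0 /dcycle /=; congr nat_of_bool.
elim: c {1 3}e => [|x c IHc] e' /=; first by rewrite andbT.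
by rewrite IHc [src x == _]eq_sym.
Qed.

Lemma card_closed_walks (R : comNzRingType) k : (0 < k)%N ->
  #|closed_walks Y k|%:R = \tr (weight_mx (fun _ : edge Y => 1 : R) ^+ k).
Proof.
move=> k0; rewrite mxtrace_weight_mxX -sum1_card big_mkcond /=.
under eq_bigr => c _.
  rewrite inE -[if _ then _ else _]/(nat_of_bool _).
  rewrite dcycle_is_walk ?size_tuple //.
  over.
rewrite exchange_big natr_sum; apply: eq_bigr => v _.
rewrite -card_walks -sum1_card; congr _%:R; rewrite [RHS]big_mkcond /=.
by apply: eq_bigr => c _; rewrite inE.
Qed.

Lemma adj_mxE (R : comNzRingType) :
  map_mx intr (adj_mx Y) = weight_mx (fun _ : edge Y => 1 : R).
Proof.
apply/matrixP => i j; rewrite !mxE sumr_const cardsE.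
by rewrite pmulrn.
Qed.

End ClosedWalks.

(** * The Euler product *)

Section EulerProduct.

Variable Y : digraph.

(** Sort the walks by period: those of period [l] are powers of primitive walks of length [l], which
    come in rotation classes of [l] elements. *)
Lemma card_closed_walks_classes n k : (0 < k <= n)%N ->
  #|closed_walks Y k| =
  (\sum_(l < n.+1) if (l %| k)%N then l * #|prime_classes Y l| else 0)%N.
Proof.
case/andP => k0 kn; rewrite -sum1_card.
(* A period divides [k <= n], so [inord] is faithful here. *)
rewrite (partition_big (fun c => inord (period c) : 'I_n.+1) predT) //=.
apply: eq_bigr => l _; rewrite sum1_card.
have -> : #|[pred c in closed_walks Y k | inord (period c) == l]|
    = #|[set c in closed_walks Y k | period c == l]|.
  apply: eq_card => c; rewrite !inE; congr andb.
  rewrite -val_eqE /= inordK // ltnS (leq_trans _ kn) //.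
  by rewrite dvdn_leq ?period_dvd_size.
case: ifP => [/dvdnP[m kE]|ndv].
  have m0 : (0 < m)%N by case: m kE k0 => // ->.
  by rewrite -card_primitive_walks; apply: card_closed_walks_period kE m0.
apply: eq_card0 => c; rewrite !inE; apply/andP => -[_ /eqP cl].
by rewrite -cl period_dvd_size in ndv.
Qed.

Definition zeta_trunc n : {poly int} :=
  \prod_(l < n.+1) \prod_(C in prime_classes Y l) \sum_(j < n.+1) 'X^(l * j).

Variable F : numFieldType.

(** The inverse of the Euler product modulo [X^(n+1)]: longer classes give factors that are 1 to
    this precision. *)
Definition euler_denom n : {poly F} :=
  \prod_(l < n.+1) (1 - 'X^l) ^+ #|prime_classes Y l|.

(** Each truncated geometric sum times [1 - X^l] is [1 - X^(l(n+1))], which is 1 modulo [X^(n+1)]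
    for [l > 0]; there are no classes of length 0. *)
Lemma eqX_zeta_trunc n :
  eqX n.+1 (map_poly intr (zeta_trunc n) * euler_denom n) 1.
Proof.
rewrite rmorph_prod -big_split /=.
rewrite [X in eqX _ _ X](_ : 1 = \prod_(l < n.+1) 1); last by rewrite big1.
apply: eqX_prod => l _; case: (posnP l) => [->|l0].
  by rewrite card_prime_classes0 big_pred0 ?rmorph1 ?mulr1 // => C;
    apply: (card0_eq (card_prime_classes0 Y)).
rewrite -prodr_const rmorph_prod -big_split /=.
rewrite [X in eqX _ _ X](_ : 1 = \prod_(C in prime_classes Y l) 1); last first.
  by rewrite big1.
apply: eqX_prod => C _; rewrite rmorph_sum /=.
under eq_bigr => j _ do rewrite map_polyXn exprM.
rewrite mulrC -opprB mulNr -subrX1 opprB -exprM.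
move=> i ni; rewrite coefB coefXn ltn_eqF ?subr0 //.
by rewrite (leq_trans ni) // leq_pmull.
Qed.

Lemma euler_denom_coef0 n : (euler_denom n)`_0 = 1.
Proof.
rewrite -horner_coef0 horner_prod big1 // => l _; rewrite horner_exp.
case: (posnP l) => [->|l0]; first by rewrite card_prime_classes0.
by rewrite hornerD hornerN hornerXn hornerC expr0n gtn_eqF // subr0 expr1n.
Qed.

Lemma logder_euler_denom n :
  logder n (fun i => #|closed_walks Y i.+1|%:R) (euler_denom n).
Proof.
pose t (l : 'I_n.+1) i : F :=
  if (l %| i.+1)%N then (l * #|prime_classes Y l|)%:R else 0.
have tP l : logder n (t l) ((1 - 'X^l) ^+ #|prime_classes Y l|).
  case: (posnP l) => [l0|l0].
    rewrite /t l0 card_prime_classes0 expr0.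
    by apply (eq_logder (@logder1 _ n)) => i _; rewrite dvd0n.
  apply (eq_logder (logder_exp #|prime_classes Y l| (@logder_1subXn F n l l0))).
  by move=> i _; rewrite /t natrM mulr_natr; case: ifP; rewrite ?mul0rn.
apply (eq_logder (logder_prod _ tP)) => i ni.
rewrite (@card_closed_walks_classes n) // natr_sum.
by apply: eq_bigr => l _; rewrite /t; case: ifP.
Qed.

End EulerProduct.

(** * The zeta function as the inverse of [D] *)

Section Zeta.

Variable Y : digraph.

Let D : {poly rat} := zeta_denom (map_mx intr (adj_mx Y)).

Lemma eqX_euler_denom n : eqX n.+1 (euler_denom Y _ n) D.
Proof.
apply: logder_uniq (logder_euler_denom Y _ (n := n)) _.
  by rewrite euler_denom_coef0 zeta_denom_coef0.
apply (eq_logder (@logder_zeta_denom _ _ _ _)) => i _.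
by rewrite adj_mxE card_closed_walks.
Qed.

Lemma eqX_zeta_trunc_denom n : eqX n.+1 (map_poly intr (zeta_trunc Y n) * D) 1.
Proof.
apply: eqX_trans (eqX_zeta_trunc Y _ (n := n)).
by apply: eqXMl; apply: eqX_sym; apply: eqX_euler_denom.
Qed.

(** Both truncations invert [D] modulo [X^(k+1)], hence agree there:
    [Zk = Zk (Zn D) = (Zk D) Zn]. *)
Lemma zeta_coef_trunc n k : (k <= n)%N ->
  (zeta_coef Y k)%:~R = (map_poly intr (zeta_trunc Y n))`_k :> rat.
Proof.
have zE m : (zeta_coef Y m)%:~R = (map_poly intr (zeta_trunc Y m))`_m :> rat.
  by rewrite coef_map.
move=> kn; rewrite zE; set Zk := map_poly _ _; set Zn := map_poly _ _.
have kP : eqX k.+1 (Zk * D) 1 by apply: eqX_zeta_trunc_denom.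
have nP : eqX k.+1 (Zn * D) 1.
  exact: eqX_leq (eqX_zeta_trunc_denom (n := n)).
rewrite -[Zk]mulr1 -(eqXMl Zk nP) // mulrCA mulrC.
by rewrite -[Zn in RHS]mul1r; apply: (eqXM kP).
Qed.

(** Multiply [denom f * Z = numer f], valid modulo [X^(k+1)], by [D] and use [Z D = 1]. *)
Lemma is_expansion_zeta (f : {fraction {poly rat}}) :
  is_expansion f (fun k => (zeta_coef Y k)%:~R) -> numer f * D = denom f.
Proof.
move=> fz; apply/polyP => k.
pose Z : {poly rat} := map_poly intr (zeta_trunc Y k).
have nZ : eqX k.+1 (denom f * Z) (numer f).
  move=> i ik; rewrite coefM -fz; apply: eq_bigr => j _.
  by rewrite (@zeta_coef_trunc k) // (leq_trans (leq_subr _ _)).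
rewrite -(eqXM nZ (q := D) (q' := D)) // -mulrA.
by rewrite (eqXMl _ (eqX_zeta_trunc_denom (n := k))) // mulr1.
Qed.

Lemma zeta_denom_neq0 (F : idomainType) n (A : 'M[F]_n) : zeta_denom A != 0.
Proof.
apply/eqP => D0; have := zeta_denom_coef0 A.
by rewrite D0 coef0 => /esym/eqP; rewrite oner_eq0.
Qed.

Lemma numer_denom (F : fieldType) (f : {fraction {poly F}}) :
  FracField.tofrac (numer f) = f * FracField.tofrac (denom f).
Proof.
rewrite /numer /denom -{2}[f]reprK; set x := repr f; unlock FracField.tofrac.
rewrite -[RHS]FracField.pi_mul; apply/eqmodP => /=.
rewrite /FracField.mulf FracField.equivfE.
rewrite !numden_Ratio ?(mulf_neq0, oner_eq0, denom_ratioP) //.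
by rewrite !mul1r !mulr1 mulrC.
Qed.

(** Existence of an expansion, so that [xget] in [zeta] does not return its default value. *)
Lemma is_expansion_inv_zeta_denom :
  is_expansion (FracField.tofrac D)^-1 (fun k => (zeta_coef Y k)%:~R).
Proof.
set f := _^-1; have E : numer f * D = denom f.
  apply/eqP; rewrite -tofrac_eq tofracM numer_denom /f mulrAC.
  by rewrite mulVf ?mul1r // tofrac_eq0 zeta_denom_neq0.
move=> k; pose Z : {poly rat} := map_poly intr (zeta_trunc Y k).
transitivity ((denom f * Z)`_k).
  rewrite coefM; apply: eq_bigr => j _.
  by rewrite (@zeta_coef_trunc k) // leq_subr.
rewrite -E -mulrA mulrC [D * _]mulrC.
by rewrite mulrC (eqXMl _ (eqX_zeta_trunc_denom (n := k))) // mulr1.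
Qed.

(** The representative of [zeta Y] need not be reduced: since numerator times [D] is the
    denominator, the multiplicity of the numerator cancels. *)
Lemma order_invariantE : order_invariant Y = (mup 1 D)%:Z.
Proof.
have zP : is_expansion (zeta Y) (fun k => (zeta_coef Y k)%:~R).
  rewrite /zeta; apply: (@xgetPex _ _ (fun f => is_expansion f _)).
  by exists (FracField.tofrac D)^-1; apply: is_expansion_inv_zeta_denom.
have ND := is_expansion_zeta zP.
have d0 : denom (zeta Y) != 0 by apply: denom_ratioP.
have n0 : numer (zeta Y) != 0.
  by apply: contraNneq d0 => n0; rewrite -ND n0 mul0r.
rewrite /order_invariant /ord_at -ND mupM ?zeta_denom_neq0 // PoszD.
by rewrite opprB addrAC subrr add0r.
Qed.

End Zeta.

(** * The rank of the Bowen-Franks group *)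

Section KernelMultiplicity.

Variable F : fieldType.

(** Geometric multiplicity is at most algebraic multiplicity: a left kernel vector [v] of [1 - A]
    satisfies [v (1 - X A) = (1 - X) v], so a basis extending one of the kernel makes [(1 - X)^d]
    divide the determinant. *)
Lemma corank_leq_mup n (A : 'M[F]_n) :
  (n - \rank (1%:M - A)%R <= mup 1%R (zeta_denom A))%N.
Proof.
set K := kermx (1%:M - A); rewrite -mxrank_ker -/K.
(* [P] is invertible and its first [d] rows span the left kernel. *)
set d := \rank K; set P := row_ebase K.
have dn : (d <= n)%N by apply: rank_leq_col.
have PK : pid_mx d *m P *m (1%:M - A) = 0 :> 'M_n.
  have KE : pid_mx d *m P = invmx (col_ebase K) *m K.
    by rewrite -{2}(mulmx_ebase K) -!mulmxA mulKmx // col_ebase_unit.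
  by rewrite KE -mulmxA mulmx_ker mulmx0.
have PA (i j : 'I_n) : (i < d)%N -> (P *m A) i j = P i j.
  move=> id; apply/esym/eqP; rewrite -subr_eq0; apply/eqP.
  have := congr1 (fun M : 'M_n => M i j) PK.
  rewrite -mulmxA mulmxBr mulmx1 [RHS]mxE mxE (bigD1 i) //= mxE eqxx id mul1r.
  rewrite big1 ?addr0 => [|k ki]; first by rewrite !mxE.
  by rewrite mxE (_ : (i == k :> nat) = false) ?mul0r // eq_sym; apply/negbTE.
set M := 1%:M - 'X *: map_mx polyC A; pose PX := map_mx polyC P.
pose D := diag_mx (\row_(i < n) (if (i < d)%N then 1 - 'X else 1 : {poly F})).
(* [P (1 - X A)] with the factor [1 - X] removed from its first [d] rows. *)
pose M' := \matrix_(i, j) (if (i < d)%N then PX i j else (PX *m M) i j).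
have PM : PX *m M = D *m M'.
  apply/matrixP => i j; rewrite mul_diag_mx ![in RHS]mxE.
  case: ifP => [id|]; last by rewrite mul1r mxE.
  rewrite mulmxBr mulmx1 -scalemxAr -map_mxM !mxE.
  by have := PA i j id; rewrite !mxE => ->; rewrite mulrBl mul1r.
have detD : \det D = (1 - 'X) ^+ d.
  rewrite det_diag; under eq_bigr do rewrite mxE.
  rewrite -big_mkcond /= (big_ord_narrow dn) /=.
  by rewrite prodr_const card_ord.
rewrite mup_geq ?zeta_denom_neq0 //.
have Pu : \det P != 0 by have := row_ebase_unit K; rewrite unitmxE unitfE.
have := congr1 (fun M => \det M) PM.
rewrite !det_mulmx detD det_map_mx -/(zeta_denom A).
move=> E; rewrite -(dvdpZr _ _ Pu) -mul_polyC E.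
have -> : 1 - 'X = - ('X - 1%:P) :> {poly F} by rewrite opprB.
by rewrite exprNn -mulrA dvdp_mull // dvdp_mulIl.
Qed.

End KernelMultiplicity.

Lemma common_denominator n (v : 'rV[rat]_n) :
  exists (a : int) (w : 'rV[int]_n), a != 0 /\ a%:~R *: v = map_mx intr w.
Proof.
have [q [a a0 vE]] := rat_poly_scale (rVpoly v).
exists a, (\row_i q`_i); split=> //; apply/rowP => i; rewrite !mxE.
rewrite -coef_rVpoly_ord vE coefZ coef_map mulrA mulfV ?mul1r //.
by rewrite intr_eq0.
Qed.

Section BowenFranksRank.

Variable Y : digraph.

Let s := #|vert Y|.
Let A : 'M[rat]_s := map_mx intr (adj_mx Y).

(** Lifts to [Z^s] stay independent modulo the image of [1 - A] over the rationals, since clearing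
    denominators makes any relation integral. Their span thus meets the image in 0, and the two
    dimensions add up to at most [s]. *)
Lemma Z_independent_corank m (x : 'I_m -> bowen_franks_group Y) :
  Z_independent x -> (m <= s - \rank (1%:M - A)%R)%N.
Proof.
move=> ind; pose Q := Quotient.quot (BF_relations Y : zmodClosed _).
pose y i : 'cV[int]_s := repr (x i : Q).
have yP (c : 'rV[int]_m) (w : 'cV[int]_s) :
    \sum_i c 0 i *: y i = (1%:M - adj_mx Y) *m w -> c = 0.
  move=> cw; apply/rowP => i; rewrite [RHS]mxE; apply: ind i.
  transitivity ((\pi_Q)%qT (\sum_i c 0 i *: y i)).
    rewrite raddf_sum; apply: eq_bigr => i _.
    by rewrite -{2}[c 0 i]intz scaler_int raddfMz /= reprK.
  rewrite -(raddf0 (\pi_Q)%qT); apply/eqP.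
  rewrite -Quotient.idealrBE subr0; apply/asboolP.
  by exists w.
pose Ym : 'M[rat]_(m, s) := \matrix_(i, j) (y i j 0)%:~R.
pose B := (1%:M - A)^T.
have YB (c : 'rV[rat]_m) (w : 'rV[rat]_s) : c *m Ym = w *m B -> c = 0.
  have [a [z [a0 zE]]] := common_denominator (row_mx c w).
  move=> cw; rewrite -(hsubmxK z) map_row_mx scale_row_mx in zE.
  have [cE wE] := eq_row_mx zE.
  have z0 : lsubmx z = 0.
    apply: (yP _ (rsubmx z)^T); apply/colP => k; apply: (intr_inj (R := rat)).
    have := congr1 (fun M : 'rV_s => (a%:~R *: M) 0 k) cw.
    rewrite /= !scalemxAl cE wE !mxE => E.
    rewrite summxE !rmorph_sum /=; apply: etrans (etrans E _).
      by apply: eq_bigr => i _; rewrite !mxE rmorphM.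
    apply: eq_bigr => i _; rewrite !mxE !(rmorphM, rmorphB) /= mulrC.
    by rewrite rmorph_nat.
  have /eqP := cE; rewrite z0 map_mx0 scalemx_eq0 intr_eq0 (negbTE a0) /=.
  by move/eqP.
have Yfree : row_free Ym.
  by apply: inj_row_free => v v0; apply: (YB v 0); rewrite v0 mul0mx.
have cap0 : (Ym :&: B)%MS = 0.
  apply/eqP; rewrite -submx0; apply/row_subP => i.
  have : (row i (Ym :&: B)%MS <= Ym :&: B)%MS by apply: row_sub.
  rewrite sub_capmx => /andP[/submxP[c cE] /submxP[w wE]].
  by rewrite cE (YB c w) ?mul0mx ?sub0mx // -cE -wE.
have := mxrank_sum_cap Ym B; rewrite cap0 mxrank0 addn0 (eqP Yfree).
rewrite mxrank_tr => E.
have := rank_leq_col (Ym + B)%MS; rewrite E => ms.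
by rewrite -(leq_add2r (\rank (1%:M - A))) subnK // rank_leq_col.
Qed.

Lemma rank_invariant_leq : (rank_invariant Y <= mup 1%R (zeta_denom A))%N.
Proof.
apply: leq_trans (corank_leq_mup A); rewrite /rank_invariant /Z_rank.
(* In the default case [xget] returns 0 and the bound is trivial. *)
case: xgetP => [n -> [[x ind] _]|//].
exact: Z_independent_corank ind.
Qed.

End BowenFranksRank.

(** * Characters of the derived digraphs *)

Lemma walk_sum_iso (R : comNzRingType) (Y X : digraph) (f : dimorph Y X) k u v :
  isomorphism f ->
  walk_sum (fun=> 1 : R) k u v
  = walk_sum (fun=> 1 : R) k (mvert f u) (mvert f v).
Proof.
case=> bv be; elim: k u => [|k IHk] u /=; first by rewrite (bij_eq bv).
rewrite [RHS](reindex (medge f)) /=; last exact: onW_bij.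
apply: eq_big => [e|e _]; first by rewrite msrc (bij_eq bv).
by rewrite IHk mtgt.
Qed.

Section DiscreteFourier.

Variables (F : numFieldType) (N : nat) (z : F).
Hypothesis z_prim : N.+1.-primitive_root z.

Lemma primrX_Zp_add (j s t : 'I_N.+1) :
  z ^+ (j * (s + t)%R) = z ^+ (j * s) * z ^+ (j * t).
Proof.
by rewrite -exprD -mulnDr /= -(prim_expr_mod z_prim) modnMmr prim_expr_mod.
Qed.

(** Orthogonality of characters: for [s != 0], multiply the geometric sum by [z ^+ s - 1], which is
    nonzero. *)
Lemma sum_primrX (s : 'I_N.+1) :
  \sum_(j < N.+1) z ^+ (j * s) = N.+1%:R * (s == 0)%:R.
Proof.
case: eqP => [->|/eqP s0].
  rewrite mulr1 (eq_bigr (fun=> 1)) ?sumr_const ?card_ord // => j _.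
  by rewrite muln0.
rewrite mulr0; have zs : z ^+ s - 1 != 0.
  rewrite subr_eq0 -(prim_order_dvd z_prim) gtnNdvd //.
  by rewrite lt0n; apply: contra s0 => /eqP s0; apply/eqP/val_inj.
apply: (mulfI zs); rewrite mulr0.
under eq_bigr => j _ do rewrite mulnC exprM.
by rewrite -subrX1 exprAC (prim_expr_order z_prim) expr1n subrr.
Qed.

End DiscreteFourier.

Section DerivedWalks.

Variables (p : nat) (X : digraph) (alpha : edge X -> padic p) (n : nat).
Variables (F : numFieldType) (z : F).
Hypothesis z_prim : (p ^ n).-1.+1.-primitive_root z.

Let N := (p ^ n).-1.+1.

(* The voltage assignment twisted by the [j]-th character of Z/p^nZ. *)
Definition twist (j : 'I_N) (e : edge X) : F := z ^+ (j * alpha e n).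

(** Fourier inversion on [Z/p^nZ]: crossing [e] shifts the fibre coordinate by its voltage, which
    the [j]-th character turns into the weight [twist j e]. *)
Lemma walk_sum_derived k (u v : vert (derived alpha n)) :
  N%:R * walk_sum (fun=> 1 : F) k u v
  = \sum_(j < N) z ^+ (j * (u.2 - v.2)%R) * walk_sum (twist j) k u.1 v.1.
Proof.
elim: k u => [|k IHk] u.
  rewrite -mulr_suml sum_primrX // subr_eq0 -mulrA; congr (_ * _).
  by rewrite -natrM mulnb andbC.
transitivity (N%:R * \sum_(e : edge X | src e == u.1)
    walk_sum (fun=> 1 : F) k
      ((tgt e, u.2 + alpha e n) : vert (derived alpha n)) v).
  congr (_ * _); rewrite /=.
  transitivity (\sum_(e : edge X | src e == u.1)
      \sum_(r : Zmod (p ^ n) | r == u.2) walk_sum (fun=> 1 : F) k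
        ((tgt e, r + alpha e n) : vert (derived alpha n)) v).
    rewrite pair_big_dep /=; apply: eq_big => [e|e _]; last by rewrite mul1r.
    by rewrite -[_ == u]/((src e.1 == u.1) && (e.2 == u.2)).
  by apply: eq_bigr => e _; rewrite big_pred1_eq.
rewrite mulr_sumr; under eq_bigr => e _ do rewrite IHk.
rewrite exchange_big /=; apply: eq_bigr => j _; rewrite mulr_sumr.
apply: eq_bigr => e _; rewrite mulrA; congr (_ * _).
rewrite -[LHS]/(z ^+ (j * (u.2 + alpha e n - v.2)%R)).
rewrite -[RHS]/(z ^+ (j * (u.2 - v.2)%R) * twist j e).
by rewrite addrAC (primrX_Zp_add z_prim).
Qed.

Lemma mxtrace_derived (Y : digraph) (f : dimorph Y (derived alpha n)) k :
  isomorphism f ->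
  \tr (weight_mx (fun _ : edge Y => 1 : F) ^+ k)
  = \sum_j \tr (weight_mx (twist j) ^+ k).
Proof.
move=> fiso; rewrite mxtrace_weight_mxX.
have N0 : N%:R != 0 :> F by rewrite pnatr_eq0.
apply: (mulfI N0).
under [in RHS]eq_bigr => j _ do rewrite mxtrace_weight_mxX.
transitivity (\sum_(u : vert (derived alpha n))
    N%:R * walk_sum (fun=> 1 : F) k u u).
  rewrite mulr_sumr [RHS](reindex (mvert f)) /=; last first.
    by apply: onW_bij; case: fiso.
  by apply: eq_bigr => u _; rewrite (walk_sum_iso _ _ _ _ fiso).
rewrite (eq_bigr _ (fun u _ => walk_sum_derived k u u)).
rewrite exchange_big mulr_sumr; apply: eq_bigr => j _.
(* On closed walks the character factor is 1, so each vertex of [X] counts [N] times, once per point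
   of its fibre. *)
under eq_bigr => u _ do rewrite subrr muln0 mul1r.
rewrite -(pair_big predT predT (fun u _ => walk_sum (twist j) k u u)) /=.
rewrite exchange_big /= sumr_const card_ord mulr_natl.
by [].
Qed.

(** Both sides have constant term 1 and, by the trace identity, the same logarithmic derivative to
    every order. *)
Lemma zeta_denom_derived (Y : digraph) (f : dimorph Y (derived alpha n)) :
  isomorphism f ->
  zeta_denom (weight_mx (fun _ : edge Y => 1 : F))
  = \prod_j zeta_denom (weight_mx (twist j)).
Proof.
move=> fiso; apply/polyP => m; apply: (@logder_uniq F m _ _ _ _ _ _ m) => //.
- rewrite zeta_denom_coef0 -horner_coef0 horner_prod big1 // => j _.
  by rewrite horner_coef0 zeta_denom_coef0.
- exact: logder_zeta_denom.
- apply (eq_logder (logder_prod _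
    (fun j => @logder_zeta_denom _ _ _ (weight_mx (twist j))))).
  by move=> i _; rewrite (mxtrace_derived _ fiso).
Qed.

End DerivedWalks.

(** * Zeros of elements of the group ring of the p-adic integers *)

Section GroupRingEvaluation.

Variables (G : zmodType) (S : comNzRingType) (h : G -> S).
Hypotheses (h0 : h 0 = 1) (hD : forall a b, h (a + b) = h a * h b).

(** The ring morphism induced by a character [h]; it will be applied to characters of finite order
    of the p-adic integers. *)
Definition gr_eval (g : group_ring G) : S := mmap intr h g.

Lemma gr_evalU c a : gr_eval << c *g a >> = c%:~R * h a.
Proof. exact: mmapU. Qed.

Fact gr_eval_is_zmod_morphism : zmod_morphism gr_eval.
Proof. exact: mmap_is_additive. Qed.

Lemma gr_eval_sum (I : Type) (s : seq I) (E : I -> group_ring G) :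
  gr_eval (\sum_(i <- s) E i) = \sum_(i <- s) gr_eval (E i).
Proof.
apply: (big_morph gr_eval) => [g1 g2|]; last exact: mmap0.
exact: mmapD.
Qed.

Fact gr_eval_is_monoid_morphism : monoid_morphism gr_eval.
Proof.
split; first by rewrite [LHS]gr_evalU h0 mulr1.
move=> g1 g2; rewrite [in LHS]/GRing.mul /= /gr_mul gr_eval_sum.
rewrite {2 3}/gr_eval !mmapE mulr_suml; apply: eq_bigr => a _.
rewrite gr_eval_sum mulr_sumr; apply: eq_bigr => b _.
by rewrite gr_evalU hD rmorphM mulrACA.
Qed.

Definition gr_eval_rmorphism : {rmorphism group_ring G -> S} :=
  HB.pack gr_eval
    (GRing.isZmodMorphism.Build _ _ gr_eval gr_eval_is_zmod_morphism)
    (GRing.isMonoidMorphism.Build _ _ gr_eval gr_eval_is_monoid_morphism).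

End GroupRingEvaluation.

Section PadicResidues.

Variable p : nat.
Hypothesis p_prime : prime p.

Let pn_gt0 n : (0 < p ^ n)%N. Proof. by rewrite expn_gt0 prime_gt0. Qed.

Lemma ltn_padic (a : padic p) n : (a n < p ^ n)%N.
Proof. by have := ltn_ord (a n); rewrite [ltnRHS](prednK (pn_gt0 n)). Qed.

Lemma padic_modn (a : padic p) m n : (m <= n)%N -> (a n %% p ^ m)%N = a m.
Proof.
elim: n => [|n IHn].
  by rewrite leqn0 => /eqP ->; rewrite modn_small ?ltn_padic.
rewrite leq_eqVlt => /predU1P[->|mn].
  by rewrite modn_small ?ltn_padic.
have aE : (a n.+1 %% p ^ n)%N = a n.
  by have := congr1 val (padicP a n); rewrite /= [X in (_ %% X)%N]prednK.
by rewrite -IHn // -aE modn_dvdm // dvdn_exp2l.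
Qed.

Lemma padic_eq_leq (a b : padic p) m n : (m <= n)%N -> a n = b n -> a m = b m.
Proof. by move=> mn ab; apply: val_inj; rewrite /= -!(padic_modn _ mn) ab. Qed.

(** Two distinct p-adic integers differ at some level and at all later ones; take the maximum over
    the finitely many pairs. *)
Lemma padic_separation (s : seq (padic p)) :
  exists n, {in s &, forall a b : padic p, a n = b n -> a = b}.
Proof.
suff [n nP] : exists n, {in [seq (a, b) | a <- s, b <- s],
    forall x : padic p * padic p, x.1 n = x.2 n -> x.1 = x.2}.
  exists n => a b sa sb; apply: (nP (a, b)).
  by apply/allpairsP; exists (a, b).
elim: [seq _ | _ <- _, _ <- _] => [|[a b] l [n nP]]; first by exists 0%N.
have [m mP] : exists m, a m = b m -> a = b.
  case: (pselect (a = b)) => [ab|ab]; first by exists 0%N.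
  apply: contrapT => /forallNP H; apply: ab; apply: padic_eq => k.
  by apply: contrapT => abk; case: (H k).
exists (maxn m n) => x; rewrite inE => /predU1P[-> /= E|xl E].
  by apply: mP; apply: padic_eq_leq E; rewrite leq_maxl.
by apply: nP => //; apply: padic_eq_leq E; rewrite leq_maxr.
Qed.

End PadicResidues.

(* The cyclotomic polynomial of index [p ^ m.+1]. *)
Definition ppow_cyclotomic p m : {poly rat} := \sum_(i < p) 'X^(p ^ m) ^+ i.

Lemma subX1_ppow_cyclotomic p m :
  ('X^(p ^ m) - 1) * ppow_cyclotomic p m = 'X^(p ^ m.+1) - 1.
Proof. by rewrite -subrX1 -exprM -expnSr. Qed.

Lemma size_ppow_cyclotomic p m : prime p ->
  size (ppow_cyclotomic p m) = (p.-1 * p ^ m).+1.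
Proof.
move=> p_prime; set P := ppow_cyclotomic p m.
have sz k : size ('X^(p ^ k) - 1 : {poly rat}) = (p ^ k).+1.
  by rewrite -polyC1 size_XnsubC ?expn_gt0 ?prime_gt0.
have X0 k : 'X^(p ^ k) - 1 != 0 :> {poly rat} by rewrite -size_poly_eq0 sz.
have PE : ('X^(p ^ m) - 1) * P = 'X^(p ^ m.+1) - 1.
  exact: subX1_ppow_cyclotomic.
have P0 : P != 0 by apply: contra_eq_neq PE => ->; rewrite mulr0 eq_sym.
have := congr1 (fun r : {poly rat} => size r) PE.
rewrite size_mul // !sz addSn /= -(prednK (n := size P)) ?size_poly_gt0 //.
rewrite addnS expnS -{2}(prednK (prime_gt0 p_prime)) mulSn => -[/eqP].
by rewrite eqn_add2l => /eqP ->.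
Qed.

(** [P] vanishes at [y] and has the degree of its minimal polynomial, the totient of [p ^ m.+1], so
    the two agree up to a scalar. *)
Lemma ppow_cyclotomic_dvd p m (y : algC) (q : {poly rat}) : prime p ->
  (p ^ m.+1).-primitive_root y -> root (map_poly ratr q) y ->
  ppow_cyclotomic p m %| q.
Proof.
move=> p_prime y_prim qy; set P := ppow_cyclotomic p m.
have yP : root (map_poly ratr P) y.
  have yX : y ^+ (p ^ m) - 1 != 0.
    rewrite subr_eq0 -(prim_order_dvd y_prim) gtnNdvd ?expn_gt0 ?prime_gt0 //.
    by rewrite ltn_exp2l ?prime_gt1.
  have := congr1 (fun r => (map_poly (ratr : rat -> algC) r).[y])
    (subX1_ppow_cyclotomic p m).
  rewrite rmorphM !rmorphB !rmorph1 /= !map_polyXn !hornerE.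
  rewrite (prim_expr_order y_prim) subrr => /eqP.
  by rewrite mulf_eq0 (negPf yX).
have [r [rE rmonic rP]] := minCpolyP y.
rewrite rP in qy; rewrite rP in yP.
rewrite -(eqp_dvdl _ (_ : r %= P)) //.
rewrite -dvdp_size_eqp // -(size_map_poly (ratr : {rmorphism rat -> algC})).
rewrite -rE (minCpoly_cyclotomic y_prim) size_cyclotomic totient_pfactor //.
by rewrite size_ppow_cyclotomic.
Qed.

(** The quotient [h] has degree below [p ^ m], so multiplying it by the sum of the [X^(i p^m)] lays
    out [p] disjoint copies of its coefficients. *)
Lemma ppow_cyclotomic_coef p m (q : {poly rat}) i j : prime p ->
  ppow_cyclotomic p m %| q -> (size q <= p ^ m.+1)%N ->
  (i < p)%N -> (j < p ^ m)%N -> q`_(j + i * p ^ m) = q`_j.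
Proof.
move=> p_prime /dvdpP[h qE] szq ip jP; set P := (p ^ m)%N in jP *.
have szh : (size h <= P)%N.
  have [->|h0] := eqVneq h 0; first by rewrite size_poly0.
  have szc := size_ppow_cyclotomic m p_prime.
  have c0 : ppow_cyclotomic p m != 0 by rewrite -size_poly_eq0 szc.
  move: szq; rewrite qE size_mul // szc addnS /= expnS -/P.
  by rewrite -{2}(prednK (prime_gt0 p_prime)) mulSn leq_add2r.
have coef k : (k < p)%N -> q`_(j + k * P) = h`_j.
  move=> kp; rewrite qE mulr_sumr coef_sum (bigD1 (Ordinal kp)) //=.
  rewrite -exprM coefMXn mulnC ltnNge leq_addl /= addnK big1 ?addr0 // => l lk.
  rewrite -exprM coefMXn; case: ltnP => // lkj; apply: nth_default.
  apply: leq_trans szh _; rewrite leq_subRL // addnC [(P * l)%N]mulnC.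
  have {}lk : (l < k)%N.
    rewrite ltn_neqAle (lk : l != k :> nat) /= -ltnS.
    rewrite -(ltn_pmul2r (leq_ltn_trans (leq0n j) jP)) mulSn mulnC.
    by apply: leq_ltn_trans lkj _; rewrite [(P * k)%N]mulnC ltn_add2r.
  rewrite -mulSn [(P * k)%N]mulnC (leq_trans _ (leq_addl _ _)) //.
  by rewrite leq_mul2r lk orbT.
by have := coef 0%N (prime_gt0 p_prime); rewrite mul0n addn0 coef // => ->.
Qed.

Lemma gr_eval_neq0 p (g : group_ring (padic p)) : prime p -> g != 0 ->
  exists n0, forall n (y : algC), y ^+ (p ^ n) = 1 -> y ^+ (p ^ n0) != 1 ->
    gr_eval (fun a : padic p => y ^+ a n) g != 0.
Proof.
move=> p_prime g0.
have /fset0Pn[a0 a0g] : msupp g != fset0.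
  apply: contra_neq g0 => s0.
  by rewrite [LHS](@monalgE (padic p) int g) s0 big_seq_fset0.
have [n0 inj] := padic_separation p_prime (msupp g).
exists n0 => n y yn yn0.
have pn0 : (0 < p ^ n)%N by rewrite expn_gt0 prime_gt0.
have [d y_prim /(dvdn_pfactor _ _ p_prime)[m mn dE]] :=
  prim_order_exists pn0 yn.
rewrite {d}dE in y_prim.
(* Order 1 would make [y ^+ (p ^ n0)] equal to 1. *)
case: m => [|m] in mn y_prim *.
  move: yn0; rewrite -(expr1n _ (p ^ n0)) -(prim_expr_order y_prim).
  by rewrite expr1 eqxx.
have n0m : (n0 <= m)%N.
  rewrite leqNgt; apply: contra yn0 => mn0; rewrite -(prim_order_dvd y_prim).
  exact: dvdn_exp2l.
(* The reduction of [g] modulo [T^(p^(m+1)) - 1]; as [n0 <= m], distinct exponents do not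
   collide. *)
pose q : {poly rat} := \sum_(a <- msupp g) (g@_a)%:~R *: 'X^(a m.+1).
have qC (a : padic p) : a \in msupp g -> q`_(a m.+1) = (g@_a)%:~R.
  move=> ag; rewrite coef_sum (big_rem a) //= coefZ coefXn eqxx mulr1.
  rewrite big_seq big1 ?addr0 // => b.
  rewrite (mem_rem_uniq _ (fset_uniq _)) => /andP[ba bg].
  rewrite coefZ coefXn; case: eqP => [ab|]; last by rewrite mulr0.
  case/eqP: ba; apply: inj => //; apply: (padic_eq_leq p_prime (leqW n0m)).
  exact/esym/val_inj.
have q0 i : q`_i != 0 -> exists2 a : padic p, a \in msupp g & a m.+1 = i :> nat.
  move=> qi; apply: contrapT => H; case/eqP: qi.
  rewrite coef_sum big_seq big1 // => a ag; rewrite coefZ coefXn.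
  by case: eqP => [E|]; [case: H; exists a | rewrite mulr0].
have szq : (size q <= p ^ m.+1)%N.
  apply/leq_sizeP => i pi; apply/eqP/negPn/negP => /q0[a _ E].
  by move: pi; rewrite -E leqNgt ltn_padic.
apply/eqP => ev0.
have qy : root (map_poly ratr q) y.
  rewrite rootE rmorph_sum /= horner_sum -[X in _ == X]ev0; apply/eqP.
  apply: eq_bigr => a _.
  rewrite map_polyZ map_polyXn hornerZ hornerXn rmorph_int.
  by rewrite -(padic_modn p_prime a mn) (prim_expr_mod y_prim).
have Pq := ppow_cyclotomic_dvd p_prime y_prim qy.
set P := (p ^ m)%N; have P0 : (0 < P)%N by rewrite expn_gt0 prime_gt0.
(* [a0] reduces to [j + i * P]; the coefficients of [q] in the class of [j] modulo [P] are all
   equal, hence nonzero. *)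
pose j := (a0 m.+1 %% P)%N; pose i := (a0 m.+1 %/ P)%N.
have jP : (j < P)%N by rewrite ltn_mod.
have ip : (i < p)%N by rewrite ltn_divLR // -expnS ltn_padic.
have qj k : (k < p)%N -> q`_(j + k * P) = q`_j.
  by move=> kp; apply: ppow_cyclotomic_coef.
have qj0 : q`_j != 0.
  by rewrite -(qj i) // addnC -divn_eq qC // intr_eq0 mcoeff_neq0.
(* A digit other than [i]: 1 if [i] is 0, and 0 otherwise. It yields a second exponent in the class
   of [a0] modulo [P], against separation at level [n0 <= m]. *)
pose k := (i == 0)%N : nat.
have kp : (k < p)%N by rewrite (leq_ltn_trans (leq_b1 _)) // prime_gt1.
have ki : k != i by rewrite /k; case: (i).
have [a1 a1g a1E] : exists2 a : padic p, a \in msupp g &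
    a m.+1 = (j + k * P)%N :> nat by apply: q0; rewrite qj.
have a01 : a0 = a1.
  apply: inj => //; apply: (padic_eq_leq p_prime n0m); apply: val_inj.
  rewrite /= -!(padic_modn p_prime _ (leqnSn m)) a1E addnC modnMDl.
  by rewrite [RHS]modn_small.
case/eqP: ki; have := congr1 (divn^~ P) a1E.
by rewrite -a01 -/i divnDr ?dvdn_mull // mulnK // divn_small.
Qed.

(** * Uniform bounds *)

Lemma size_zeta_denom (R : comNzRingType) n (A : 'M[R]_n) :
  (size (zeta_denom A) <= n.+1)%N.
Proof.
rewrite /zeta_denom /determinant; apply: leq_trans (size_sum _ _ _) _.
apply/bigmax_leqP => s _; rewrite size_Msign.
apply: leq_trans (size_poly_prod_leq _ _) _; rewrite card_ord.
(* Sizes are degrees plus one: [n] factors of size at most 2 give size at most [2n + 1 - n]. *)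
rewrite -[X in (_ <= X.+1)%N](addnK n) -subSn ?leq_addl // leq_sub2r // ltnS.
rewrite addnn -muln2 -[X in (_ <= X * _)%N]card_ord -sum_nat_const.
apply: leq_sum => i _; rewrite !mxE mulrC mul_polyC.
apply: leq_trans (size_polyD _ _) _; rewrite size_polyN geq_max.
apply/andP; split; last by rewrite (leq_trans (size_scale_leq _ _)) ?size_polyX.
by case: (_ == _); rewrite ?size_poly1 ?size_poly0.
Qed.

Lemma mup_zeta_denom (F : fieldType) n (A : 'M[F]_n) x :
  (mup x (zeta_denom A) <= n)%N.
Proof.
rewrite mup_leq ?zeta_denom_neq0 //; apply/negP => /dvdp_leq.
move=> /(_ (zeta_denom_neq0 A)); rewrite size_exp_XsubC => H.
by have := leq_trans H (size_zeta_denom A); rewrite ltnn.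
Qed.

Lemma mup1_zeta_denom0 (F : fieldType) n (A : 'M[F]_n) :
  \det (1%:M - A) != 0 -> mup 1 (zeta_denom A) = 0%N.
Proof.
move=> d0; apply: mupNroot; apply: contra d0; rewrite /root /zeta_denom.
rewrite -horner_evalE -det_map_mx (_ : map_mx _ _ = 1%:M - A) //.
apply/matrixP => i j; rewrite !mxE /= /horner_eval hornerD hornerN hornerM.
by rewrite hornerX mul1r hornerC hornerMn hornerC.
Qed.

Lemma mup_prod (F : fieldType) (I : finType) x (G : I -> {poly F}) :
  (forall i, G i != 0) -> mup x (\prod_i G i) = (\sum_i mup x (G i))%N.
Proof.
move=> G0.
have [] // : mup x (\prod_i G i) = (\sum_i mup x (G i))%N /\ \prod_i G i != 0.
elim/big_rec2: _ => [|i m q _ [IHm q0]].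
  by rewrite mupNroot ?root1 // oner_neq0.
by rewrite mupM // IHm mulf_neq0.
Qed.

(** Divisibility by a power of [X - x] survives extension of scalars; this moves the problem to
    [algC], where the characters take values. *)
Lemma leq_mup_map (F L : fieldType) (f : {rmorphism F -> L}) x (q : {poly F}) :
  q != 0 -> (mup x q <= mup (f x) (map_poly f q))%N.
Proof.
move=> q0; rewrite mup_geq ?map_poly_eq0 // -map_polyXsubC -rmorphXn dvdp_map.
by rewrite -mup_geq.
Qed.

Section TowerBound.

Variables (p : nat) (p_prime : prime p).
Variables (X : digraph) (alpha : edge X -> padic p).
Hypothesis L_neq0 : padic_bowen_franks alpha != 0.

Lemma mup_zeta_denom_derived : exists C : nat, forall n (Y : digraph)
    (f : dimorph Y (derived alpha n)), isomorphism f ->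
  (mup 1 (zeta_denom (map_mx intr (adj_mx Y)) : {poly rat}) <= C)%N.
Proof.
have [n0 n0P] := gr_eval_neq0 p_prime L_neq0.
(* At most [p ^ n0] characters contribute, each at most the degree bound [#|vert X|]; neither number
   depends on [n]. *)
exists (p ^ n0 * #|vert X|)%N => n Y f fiso.
have pn0 : (0 < p ^ n)%N by rewrite expn_gt0 prime_gt0.
have [z z_prim] := C_prim_root_exists (ltn0Sn (p ^ n).-1).
apply: leq_trans (leq_mup_map (ratr : {rmorphism rat -> algC}) 1 _) _.
  exact: zeta_denom_neq0.
have -> : map_poly (ratr : rat -> algC) (zeta_denom (map_mx intr (adj_mx Y)))
    = zeta_denom (weight_mx (fun _ : edge Y => 1 : algC)).
  rewrite /zeta_denom -det_map_mx -adj_mxE; congr (\det _).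
  apply/matrixP => i j; rewrite !mxE rmorphB rmorphM /= map_polyX map_polyC /=.
  by rewrite rmorph_nat !rmorph_int.
rewrite rmorph1 (zeta_denom_derived z_prim fiso).
rewrite mup_prod => [|j]; last exact: zeta_denom_neq0.
(* The characters of order dividing [p ^ n0]; the corresponding [z ^+ j] are distinct roots of
   [X^(p^n0) - 1]. *)
pose S := [set j : 'I_(p ^ n).-1.+1 | (z ^+ j) ^+ (p ^ n0) == 1].
have SC : (#|S| <= p ^ n0)%N.
  rewrite cardE -(size_map (fun j : 'I_(p ^ n).-1.+1 => z ^+ j)).
  apply: max_unity_roots; first by rewrite expn_gt0 prime_gt0.
    apply/allP => _ /mapP[j jS ->]; rewrite unity_rootE.
    by move: jS; rewrite mem_enum inE.
  rewrite map_inj_uniq ?enum_uniq // => i j /eqP.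
  by rewrite (eq_prim_root_expr z_prim) !modn_small // => /eqP/val_inj.
rewrite (bigID (mem S)) /= [X in (_ + X)%N]big1 ?addn0 => [|j jS].
  apply: leq_trans (leq_mul SC (leqnn _)); rewrite -sum_nat_const.
  by apply: leq_sum => j _; apply: mup_zeta_denom.
(* Outside [S] the factor at [u = 1] is the image of [padic_bowen_franks alpha] under a character,
   nonzero by the choice of [n0]. *)
apply: mup1_zeta_denom0.
have yn : (z ^+ j) ^+ (p ^ n) = 1.
  by rewrite exprAC -[X in z ^+ X](prednK pn0) (prim_expr_order z_prim) expr1n.
pose h (a : padic p) : algC := (z ^+ j) ^+ a n.
have h0 : h 0 = 1 by [].
have hD a b : h (a + b) = h a * h b.
  rewrite /h -!exprM -(primrX_Zp_add z_prim); congr (z ^+ (j * _)).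
  by rewrite -padic_addE.
have := n0P n _ yn; rewrite inE in jS => /(_ jS).
rewrite -[gr_eval _ _]/(gr_eval_rmorphism h0 hD _) -det_map_mx.
rewrite (_ : map_mx _ _ = 1%:M - weight_mx (twist alpha z j)) //.
apply/matrixP => i k; rewrite !mxE rmorphB rmorph_sum rmorph_nat; congr (_ - _).
apply: eq_bigr => e _; rewrite [LHS]gr_evalU mul1r /h /twist.
by rewrite exprM.
Qed.

End TowerBound.

Theorem lemma7p7 (p : nat) (p_prime : prime p) (X : nat -> digraph)
    (f : forall n : nat, dimorph (X n.+1) (X n))
    (tower : Zp_tower p f)
    (connected : forall n : nat, strongly_connected (X n))
    (alpha : edge (X 0%N) -> padic p)
    (voltage : tower_voltage f alpha)
    (L_neq0 : padic_bowen_franks alpha != 0) :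
  (exists C : int, forall n : nat, `|order_invariant (X n)| <= C) /\
  (exists C : nat, forall n : nat, (rank_invariant (X n) <= C)%N) /\
  (exists C : int, forall n : nat, `|defect (X n)| <= C).
Proof.
(* Every level is isomorphic to a derived digraph of [alpha], and one constant [C] serves all of
   them. *)
have [phi [phi_iso _ _ _]] := voltage.
have [C CP] := mup_zeta_denom_derived p_prime L_neq0.
have aC n : `|order_invariant (X n)| <= C%:Z.
  by rewrite order_invariantE ger0_norm // lez_nat; apply: CP (phi_iso n).
have bC n : (rank_invariant (X n) <= C)%N.
  exact: leq_trans (rank_invariant_leq _) (CP _ _ _ (phi_iso n)).
split; first by exists C%:Z.
split; first by exists C.
exists (C%:Z + C%:Z) => n; rewrite (le_trans (ler_normB _ _)) // lerD //.
by rewrite ger0_norm // lez_nat.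
Qed.
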